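(* Let $n\ge 1$, $s\in(0,1)$, let $a$ be a spectral measure on $\mathbb S^{n-1}$ (as in the context), let $\Omega\subset\mathbb R^n$ be open and let $u\in L^\infty(\mathbb R^n)$ be continuous in $\overline\Omega$. Then $u$ satisfies the asymptotic expansion $$u(x)=\mathscr M^s_r u(x)+\mathcal O(r^2)\qquad\text{as } r\to0$$ for all $x\in\Omega$ in the viscosity sense if and only if $\mathcal L u=0$ in $\Omega$ in the viscosity sense.
   Context: A spectral measure is a non-negative finite Borel measure $a$ on the unit sphere $\mathbb S^{n-1}\subset\mathbb R^n$ with $0<\int_{\mathbb S^{n-1}}da\le\Lambda$ for some $\Lambda>0$. For $u:\mathbb R^n\to\mathbb R$ set $\delta(u,x,y)=2u(x)-u(x-y)-u(x+y)$ and $$\mathcal L u(x)=\int_0^\infty d\rho\int_{\mathbb S^{n-1}}da(\omega)\,\frac{\delta(u,x,\rho\omega)}{\rho^{1+2s}},$$ $$\mathscr M^s_r u(x)=c(n,s,a)\,r^{2s}\int_r^\infty d\rho\int_{\mathbb S^{n-1}}da(\omega)\,\frac{u(x+\rho\omega)+u(x-\rho\omega)}{(\rho^2-r^2)^s\rho},\qquad c(n,s,a)=\frac{\sin\pi s}{\pi}\Big(\int_{\mathbb S^{n-1}}da\Big)^{-1}.$$ Touching functions: for $x\in\Omega$, a neighborhood $U\subset\Omega$ of $x$ and $\varphi\in C^2(\overline U)$, let $v=\varphi$ in $U$ and $v=u$ in $\mathbb R^n\setminus U$. Viscosity solution: $u\in L^\infty(\mathbb R^n)$ lower (resp. upper)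 semicontinuous in $\overline\Omega$ is a viscosity supersolution (resp. subsolution) of $\mathcal Lu=0$ if for every $x\in\Omega$, every neighborhood $U\subset\Omega$ of $x$ and every $\varphi\in C^2(\overline U)$ with $\varphi(x)=u(x)$ and $\varphi(y)<u(y)$ (resp. $\varphi(y)>u(y)$) for $y\in U\setminus\{x\}$, the function $v$ above satisfies $\mathcal Lv(x)\ge0$ (resp. $\le0$). A viscosity solution is a continuous function that is both. Mean value in viscosity sense: $u$ (lower, resp. upper, semicontinuous in $\overline\Omega$, bounded) satisfies $u(x)=\mathscr M_r^s u(x)+\mathcal O(r^2)$ in the viscosity sense at $x$ from above/below if for every neighborhood $U\subset\Omega$ of $x$ and every $\varphi\in C^2(\overline U)$ with $\varphi(x)=u(x)$ and $\varphi<u$ (resp. $\varphi>u$) on $U\setminus\{x\}$, the function $v$ above satisfies $v(x)\ge \mathscr M_r^s v(x)+\mathcal O(r^2)$ (resp. $v(x)\le\mathscr M^s_r v(x)+\mathcal O(r^2)$) as $r\to0$; the expansion holds in the viscosity sense if both requirements hold. *)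

(* Defs.v *)
From HB Require Import structures.
From mathcomp Require Import all_boot all_order all_algebra.
From mathcomp Require Import all_classical all_reals all_analysis.
Set Implicit Arguments. Unset Strict Implicit. Unset Printing Implicit Defensive.
Import Order.TTheory GRing.Theory Num.Theory.
Import numFieldNormedType.Exports.
Local Open Scope classical_set_scope.
Local Open Scope ring_scope.

Section borel_rV.
Variables (R : realType) (n : nat).
Lemma rV_sigmaC (A : set 'rV[R]_n) :
  <<s (@open 'rV[R]_n) >> A -> <<s (@open 'rV[R]_n) >> (~` A).
Proof. by move=> sGA; rewrite -setTD; exact: sigma_algebraCD. Qed.
HB.instance Definition _ := @isMeasurable.Build default_measure_display
  'rV[R]_n <<s (@open 'rV[R]_n) >> (@sigma_algebra0 _ setT _) rV_sigmaC
  (@sigma_algebra_bigcup _ setT _).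
End borel_rV.

Section defs.
Variables (R : realType) (n : nat).
Local Notation V := 'rV[R]_n.

Definition sqnorm (w : V) : R := \sum_(i < n) (w ord0 i) ^+ 2.
Definition sphere : set V := [set w | sqnorm w = 1].

Definition spectral_measure (a : {measure set V -> \bar R}) : Prop :=
  a (~` sphere) = 0%E /\ (0 < a sphere)%E /\ exists Lambda : R, (a sphere <= Lambda%:E)%E.

Definition unitv (i : 'I_n) : V := delta_mx ord0 i.

Definition C2_closure (U : set V) (phi : V -> R) : Prop :=
  [/\ {within closure U, continuous phi},
      forall i x, U x -> derivable phi x (unitv i),
      forall i j x, U x -> derivable ('D_(unitv j) phi) x (unitv i),
      forall i, exists g : V -> R, {within closure U, continuous g} /\
        forall x, U x -> g x = 'D_(unitv i) phi x &
      forall i j, exists g : V -> R, {within closure U, continuous g} /\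
        forall x, U x -> g x = 'D_(unitv i) ('D_(unitv j) phi) x].

Definition Linf (u : V -> R) : Prop :=
  measurable_fun setT u /\ exists M : R, forall x, `|u x| <= M.

Definition lsc_on (A : set V) (u : V -> R) : Prop :=
  forall x, A x -> forall e : R, 0 < e -> \forall y \near x, A y -> u x - e < u y.
Definition usc_on (A : set V) (u : V -> R) : Prop :=
  forall x, A x -> forall e : R, 0 < e -> \forall y \near x, A y -> u y < u x + e.

Definition delta (u : V -> R) (x y : V) : R := 2 * u x - u (x - y) - u (x + y).

Definition touch (U : set V) (phi u : V -> R) : V -> R :=
  fun y => if y \in U then phi y else u y.

Variables (s : R) (a : {measure set V -> \bar R}).

Definition Lop (u : V -> R) (x : V) : \bar R :=
  (\int[lebesgue_measure]_(rho in `]0%R, +oo[)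
     ((\int[a]_(w in sphere) (delta u x (rho *: w))%:E) *
      ((rho `^ (1 + 2 * s))^-1)%:E))%E.

Definition cnsa : R := sin (pi * s) / pi * (fine (a sphere))^-1.

Definition Mr (r : R) (u : V -> R) (x : V) : \bar R :=
  ((cnsa * r `^ (2 * s))%:E *
   \int[lebesgue_measure]_(rho in `]r, +oo[)
     ((\int[a]_(w in sphere) (u (x + rho *: w) + u (x - rho *: w))%:E) *
      (((rho ^+ 2 - r ^+ 2) `^ s * rho)^-1)%:E))%E.

Definition visc_super (Omega : set V) (u : V -> R) : Prop :=
  Linf u /\ lsc_on (closure Omega) u /\
  forall x (U : set V) (phi : V -> R), Omega x -> open U -> U x -> U `<=` Omega ->
    C2_closure U phi -> phi x = u x -> (forall y, U y -> y <> x -> phi y < u y) ->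
    (0 <= Lop (touch U phi u) x)%E.

Definition visc_sub (Omega : set V) (u : V -> R) : Prop :=
  Linf u /\ usc_on (closure Omega) u /\
  forall x (U : set V) (phi : V -> R), Omega x -> open U -> U x -> U `<=` Omega ->
    C2_closure U phi -> phi x = u x -> (forall y, U y -> y <> x -> u y < phi y) ->
    (Lop (touch U phi u) x <= 0)%E.

Definition visc_solution (Omega : set V) (u : V -> R) : Prop :=
  {within closure Omega, continuous u} /\ visc_super Omega u /\ visc_sub Omega u.

Definition right0 : set_system R := 0%R^'+.

Definition mv_above (Omega : set V) (u : V -> R) (x : V) : Prop :=
  Linf u /\ lsc_on (closure Omega) u /\
  forall (U : set V) (phi : V -> R), open U -> U x -> U `<=` Omega ->
    C2_closure U phi -> phi x = u x -> (forall y, U y -> y <> x -> phi y < u y) ->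
    exists f : R -> R, f =O_right0 (fun r : R => r ^+ 2) /\
      forall r, 0 < r -> (Mr r (touch U phi u) x + (f r)%:E <= (touch U phi u x)%:E)%E.

Definition mv_below (Omega : set V) (u : V -> R) (x : V) : Prop :=
  Linf u /\ usc_on (closure Omega) u /\
  forall (U : set V) (phi : V -> R), open U -> U x -> U `<=` Omega ->
    C2_closure U phi -> phi x = u x -> (forall y, U y -> y <> x -> u y < phi y) ->
    exists f : R -> R, f =O_right0 (fun r : R => r ^+ 2) /\
      forall r, 0 < r -> ((touch U phi u x)%:E <= Mr r (touch U phi u) x + (f r)%:E)%E.

Definition mv_visc (Omega : set V) (u : V -> R) (x : V) : Prop :=
  mv_above Omega u x /\ mv_below Omega u x.

End defs.

(* Main.v *)
(* Let v be a touching function, G(rho) the integral of delta(v, x, rho w) over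
   the sphere and k_r(rho) = ((rho^2 - r^2)^s rho)^-1, so that Lv(x) is the
   integral of G k_0 over (0, oo).  The reflection formula B(s, 1 - s) =
   pi / sin(pi s) says exactly that M_r 1 = 1, whence v(x) - M_r v(x) equals
   c r^(2s) times the integral of G k_r over (r, oo).  Since v is C^2 near x,
   G(rho) = O(rho^2), and as k_r - k_0 >= 0 has an explicit primitive against
   rho^2, the two integrals differ by O(r^(2 - 2s)): thus
   v(x) - M_r v(x) = c r^(2s) Lv(x) + O(r^2), and the sign of Lv(x) decides.
   The touching function is bounded on one side only, so Lv(x) may be infinite;
   the positive and negative parts of G are therefore compared separately. *)
Require Import Defs.
From HB Require Import structures.
From mathcomp Require Import all_boot all_order all_algebra.
From mathcomp Require Import all_classical all_reals all_analysis.
From mathcomp Require Import measurable_realfun.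
From mathcomp Require Import ring lra.
Import Order.TTheory GRing.Theory Num.Theory.
Import numFieldNormedType.Exports.
Local Open Scope classical_set_scope.
Local Open Scope ring_scope.
Set Implicit Arguments.
Unset Strict Implicit.

(** * The reflection formula *)

(** The equivalence holds for each touching function [v] separately, so all reduces to a statement
    about the one function G on the half-line. Two features of the definitions shape the proof.
    Since [U] may be unbounded, [v] is known to be bounded only on bounded sets and, by the touching
    condition, on one side. So G has no growth control at infinity, and far from 0 the kernels are
    compared by a factor 1 + O(r^2), which is harmless even to an infinite integral. Moreover the
    inequality with [f r] is demanded for every r > 0, although its size matters only near 0. For
    large r the error is the integral of the part of G that one-sided boundedness makes finite.
    Conversely, dividing the expansion by r^(2s) leaves O(r^(2-2s)), which vanishes because s < 1.
    The reflection formula rests on multiplication by three: in the alternating pole expansion of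
    the cosecant an odd multiplier keeps the signs alternating and gives a linear relation among
    cosecants, whereas doubling would produce cotangents. *)

Section Cosecant.
Context {R : realType}.
Implicit Types x y : R.

Lemma sin_le_id y : 0 <= y -> sin y <= y.
Proof.
rewrite le_eqVlt => /predU1P[<-|y0]; first by rewrite sin0.
have [c _] := @MVT R sin cos 0 y y0 (fun x _ => is_derive_sin x)
  (continuous_subspaceT (@continuous_sin R)).
by rewrite sin0 !subr0 => ->; rewrite ler_piMl ?cos_le1 ?ltW.
Qed.

Lemma cos_ge_quadratic y : 0 <= y -> 1 - y ^+ 2 / 2 <= cos y.
Proof.
move=> y0; have -> : cos y = 1 - 2 * sin (y / 2) ^+ 2.
  have {1}-> : y = (y / 2) *+ 2 by rewrite -mulr_natr; field.
  by rewrite cos_mulr2n cos2sin2; ring.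
have [y2|y2] := leP y 2.
  have h0 : 0 <= sin (y / 2).
    apply: sin_ge0_pi; have := @pi_ge2 R; lra.
  have h1 : sin (y / 2) <= y / 2 by apply: sin_le_id; lra.
  nra.
have := sin_max (y / 2); rewrite ler_norml; nra.
Qed.

Lemma sin_ge_cubic y : 0 <= y -> y * (1 - y ^+ 2 / 2) <= sin y.
Proof.
rewrite le_eqVlt => /predU1P[<-|y0]; first by rewrite sin0 mul0r.
have [c] := @MVT R sin cos 0 y y0 (fun x _ => is_derive_sin x)
  (continuous_subspaceT (@continuous_sin R)).
rewrite in_itv/= sin0 !subr0 => /andP[c0 cy] ->.
rewrite mulrC ler_pM2r//; apply: le_trans (cos_ge_quadratic (ltW c0)); nra.
Qed.

Lemma sin_triple y : sin (3 * y) = 3 * sin y - 4 * sin y ^+ 3.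
Proof.
have -> : 3 * y = y *+ 2 + y by rewrite -mulr_natl; ring.
have h := cos2Dsin2 y.
rewrite sinD sin_mulr2n cos_mulr2n.
have -> : cos y ^+ 2 = 1 - sin y ^+ 2 by rewrite -h; ring.
have -> : (cos y * sin y) *+ 2 * cos y = 2 * sin y * cos y ^+ 2 by ring.
have -> : cos y ^+ 2 = 1 - sin y ^+ 2 by rewrite -h; ring.
ring.
Qed.

Lemma sin_pi3_sqr : sin (pi / 3) ^+ 2 = 3 / 4 :> R.
Proof.
have p2 := @pi_ge2 R.
have h0 : 0 < sin (pi / 3 : R) by apply: sin_gt0_pi; lra.
have := sin_triple (pi / 3); have -> : 3 * (pi / 3) = pi :> R by field.
rewrite sinpi => h.
have : sin (pi / 3) * (3 / 4 - sin (pi / 3) ^+ 2) = 0 :> R by nra.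
by move/eqP; rewrite mulf_eq0 gt_eqF//= subr_eq0 => /eqP.
Qed.

Lemma cos_pi3 : cos (pi / 3) = 1 / 2 :> R.
Proof.
have p2 := @pi_ge2 R.
have h0 : 0 < cos (pi / 3 : R) by apply: cos_gt0_pihalf; lra.
have := cos2Dsin2 (pi / 3 : R); rewrite sin_pi3_sqr => h; nra.
Qed.

(** With a = pi x / 3, the last two terms combine to pi sin a / (sin(pi/3 + a) sin(pi/3 - a)),
    because the two sines differ by 2 cos(pi/3) sin a = sin a. The denominator is 3/4 - sin(a)^2,
    the cofactor of 4 sin a in sin(3a). *)
Lemma cosec_triplication x : 0 < x < 1 ->
  3 * (pi / sin (pi * x)) = pi / sin (pi * (x / 3))
    - pi / sin (pi * ((x + 1) / 3)) + pi / sin (pi * ((x + 2) / 3)).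
Proof.
move=> /andP[x0 x1]; have p0 := @pi_gt0 R.
set a := pi * (x / 3).
have -> : pi * x = 3 * a by rewrite /a; field.
have e1 : pi * ((x + 1) / 3) = a + pi / 3 by rewrite /a; field.
have e2 : pi * ((x + 2) / 3) = pi - (pi / 3 - a) by rewrite /a; field.
have s0 : 0 < sin a by apply: sin_gt0_pi; rewrite /a; nra.
have s1 : 0 < sin (pi * ((x + 1) / 3)) by apply: sin_gt0_pi; nra.
have s2 : 0 < sin (pi * ((x + 2) / 3)) by apply: sin_gt0_pi; nra.
have s3 : 0 < sin (3 * a) by apply: sin_gt0_pi; rewrite /a; nra.
move: s1 s2 s3; rewrite e1 e2 sinB sinpi cospi mul0r sub0r mulN1r opprK.
rewrite sinB sinD sin_triple cos_pi3.
set p := sin a in s0 *; set q := cos a; set h := sin (pi / 3) => s1 s2 s3.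
have hq : h ^+ 2 * q ^+ 2 = 3 / 4 * (1 - p ^+ 2).
  by rewrite /h sin_pi3_sqr /p /q sin2cos2; ring.
have s3' : 0 < 3 - 4 * p ^+ 2 by rewrite -(pmulr_rgt0 _ s0); nra.
have k : (p * (1 / 2) + q * h) * (h * q - 1 / 2 * p) = 3 / 4 - p ^+ 2.
  have -> : (p * (1 / 2) + q * h) * (h * q - 1 / 2 * p)
     = h ^+ 2 * q ^+ 2 - p ^+ 2 / 4 by field.
  by rewrite hq; field.
have ne1 : p * (1 / 2) + q * h != 0 by rewrite gt_eqF.
have ne2 : h * q - 1 / 2 * p != 0 by rewrite gt_eqF.
have -> : pi / p - pi / (p * (1 / 2) + q * h) + pi / (h * q - 1 / 2 * p)
  = pi / p + pi * p / ((p * (1 / 2) + q * h) * (h * q - 1 / 2 * p)).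
  by field; rewrite (gt_eqF s0) ?gt_eqF //; lra.
rewrite k; field; rewrite !gt_eqF//; nra.
Qed.

Lemma cosec_ge x : 0 < x < 1 -> x^-1 <= pi / sin (pi * x).
Proof.
move=> /andP[x0 x1]; have p0 := @pi_gt0 R.
have s0 : 0 < sin (pi * x) by apply: sin_gt0_pi; nra.
rewrite ler_pdivlMr// mulrC ler_pdivrMr//; apply: sin_le_id; nra.
Qed.

(** Since pi < 4, the argument y = pi x stays in [0, 1], where (1 + y^2)(1 - y^2/2) >= 1, and 16 x^2
    dominates y^2. *)
Lemma cosec_le x : 0 < x <= 1 / 4 -> pi / sin (pi * x) <= x^-1 + 16 * x.
Proof.
move=> /andP[x0 x1]; have p0 := @pi_gt0 R.
have p4 : pi < 4 :> R by have := @pihalf_lt2 R; lra.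
have s0 : 0 < sin (pi * x) by apply: sin_gt0_pi; nra.
rewrite ler_pdivrMr//.
have y1 : pi * x <= 1 by nra.
have y0 : 0 < pi * x by nra.
have := sin_ge_cubic (ltW y0).
set y := pi * x in s0 y0 y1 * => h.
have -> : pi = y / x by rewrite /y; field; rewrite gt_eqF.
rewrite -(ler_pM2r x0) mulfVK ?gt_eqF//.
have -> : (x^-1 + 16 * x) * sin y * x = (1 + 16 * x ^+ 2) * sin y by field; rewrite gt_eqF.
have : y ^+ 2 <= 16 * x ^+ 2 by rewrite exprMn ler_pM2r ?exprn_gt0//; nra.
move: (16 * x ^+ 2) => z hz.
have yy : 0 <= y ^+ 2 <= 1 by rewrite sqr_ge0 expr_le1// ltW.
apply: (@le_trans _ _ ((1 + y ^+ 2) * (y * (1 - y ^+ 2 / 2)))).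
  rewrite mulrCA ler_peMr ?(ltW y0)//; move: (y ^+ 2) yy => w /andP[w0 w1].
  have : 0 <= w * (1 - w) by rewrite mulr_ge0// subr_ge0.
  nra.
by apply: ler_pM => //; [lra|rewrite mulr_ge0//; lra|lra].
Qed.

End Cosecant.

Section ThreeTerm.
Context {R : realType}.

(* Iterating the relation along x / 3^k puts a definite part of the weight near
   0, where f is small; hence the supremum of |f| strictly improves on itself. *)
Lemma three_term_eq0 (f : R -> R) (M C : R) :
  (forall x : R, 0 < x < 1 ->
     3 * f x = f (x / 3) - f ((x + 1) / 3) + f ((x + 2) / 3)) ->
  (forall x : R, 0 < x < 1 -> `|f x| <= M) ->
  (forall x : R, 0 < x <= 1 / 4 -> `|f x| <= C * x) ->
  forall x : R, 0 < x < 1 -> f x = 0.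
Proof.
move=> f3 fM fC.
pose A : set R := [set `|f x| | x in `]0, 1[%classic].
have supA : has_sup A.
  split; first by exists `|f (1 / 2)|, (1 / 2) => //=; rewrite in_itv/=; lra.
  by exists M => _ [x /= + <-]; rewrite in_itv/=; exact: fM.
set S := sup A.
have fS (x : R) : 0 < x < 1 -> `|f x| <= S.
  by move=> x01; apply: ub_le_sup; [exact: supA.2|exists x => //=; rewrite in_itv].
have S0 : 0 <= S by apply: le_trans (fS (1/2) _) => //; lra.
suff S_eq0 : S = 0.
  by move=> x x01; apply/eqP; rewrite -normr_eq0 eq_le normr_ge0 andbT -S_eq0 fS.
(* One use of the relation bounds [|f x|] by a third of [|f (x / 3)|] plus two thirds of the
   supremum, so k uses leave weight 3^-k on the point x / 3^k. *)
have step k (x : R) : 0 < x < 1 ->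
    `|f x| <= (1 - 3^-1 ^+ k) * S + 3^-1 ^+ k * `|f (x * 3^-1 ^+ k)|.
  elim: k x => [|k ih] x x01; first by rewrite !expr0 subrr mul0r add0r mul1r mulr1.
  have h1 := fS ((x + 1) / 3) ltac:(lra).
  have h2 := fS ((x + 2) / 3) ltac:(lra).
  have h3 := ih (x / 3) ltac:(lra).
  have : 3 * `|f x| <= `|f (x / 3)| + `|f ((x + 1) / 3)| + `|f ((x + 2) / 3)|.
    rewrite -[3 in leLHS]ger0_norm// -normrM f3//.
    by rewrite (le_trans (ler_normD _ _))// lerD2r ler_normB.
  move: h3; rewrite exprS (mulrA x).
  move: (3^-1 ^+ k) `|f (x / 3 * _)| => t F h3 h4.
  have -> : (1 - 3^-1 * t) * S + 3^-1 * t * F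
    = 3^-1 * ((1 - t) * S + t * F) + 2 / 3 * S by field.
  lra.
apply/eqP; rewrite eq_le S0 andbT leNgt; apply/negP => Sgt0.
have C0 : 0 <= C by have := fC (1 / 4) ltac:(lra); have := normr_ge0 (f (1/4)); lra.
(* With this k the point x / 3^k lies where the linear bound holds, and the bound there is at most S
   / 2. Hence S <= S (1 - t / 2) with t = 3^-k, which is absurd for S > 0. *)
have [k kP] : exists k : nat, (3^-1 ^+ k : R) <= 1 / 4 /\ C * 3^-1 ^+ k <= S / 2.
  have := @cvg_expr R 3^-1 ltac:(by rewrite ger0_norm//; lra).
  move/cvgrPdist_le => h.
  pose e := Num.min (1 / 4) (S / 2 / (C + 1)).
  have e0 : 0 < e by rewrite /e lt_min; apply/andP; split; [lra|apply: divr_gt0; lra].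
  have [k _ /(_ k (leqnn k))] := h e e0.
  rewrite /= sub0r normrN ger0_norm ?exprn_ge0// le_min => /andP[k1 k2].
  exists k; split => //; move: k2; rewrite ler_pdivlMr; last lra.
  have : 0 <= 3^-1 ^+ k :> R by rewrite exprn_ge0.
  nra.
set t := 3^-1 ^+ k in kP; have t0 : 0 < t by rewrite exprn_gt0.
have : S <= S * (1 - t / 2).
  apply: sup_le_ub; first exact: supA.1.
  move=> _ [x /= + <-]; rewrite in_itv/= => x01.
  apply: (le_trans (step k x x01)); rewrite -/t.
  have /andP[x0 x1] := x01; have [t4 Ct] := kP.
  have xt : 0 < x * t <= 1 / 4 by apply/andP; split; [rewrite mulr_gt0|nra].
  have F : `|f (x * t)| <= S / 2.
    apply: (le_trans (fC _ xt)); apply: le_trans Ct.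
    by rewrite ler_wpM2l// ler_piMl// ltW.
  have := ler_wpM2l (ltW t0) F; lra.
nra.
Qed.

End ThreeTerm.

(** * The Beta integral B(s, 1 - s) *)

Section BetaIntegral.
Context {R : realType}.
Notation mu := (@lebesgue_measure R).
Implicit Types s t c : R.

Lemma continuous_expR_lin c : continuous (fun t => expR (c * t)).
Proof.
move=> t; apply: continuous_comp; last exact: continuous_expR.
by apply: continuousM => //; exact: cst_continuous.
Qed.

Lemma integral_expRN c : 0 < c ->
  (\int[mu]_(t in `[0%R, +oo[) (expR (- c * t))%:E = (c^-1)%:E)%E.
Proof.
move=> c0; pose F t := - (c^-1) * expR (- c * t).
have dF t : is_derive t 1 F (expR (- c * t)).
  rewrite /F; apply: is_derive_eq.
  by rewrite /GRing.scale/= mulr1; field; rewrite gt_eqF.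
rewrite (@ge0_continuous_FTC2y _ _ F 0 0).
- by rewrite /F mulr0 expR0 mulr1 sub0e EFinN oppeK.
- by move=> *; exact: expR_ge0.
- by apply: continuous_subspaceT; exact: continuous_expR_lin.
- rewrite -(mulr0 (- c^-1)); apply: cvgMr.
  under eq_fun do rewrite mulNr.
  apply: (cvg_comp (fun t => c * t) (fun t => expR (- t))); last exact: cvgr_expR.
  exact: gt0_cvgMry.
- by move=> x _; exact: ex_derive.
- apply: cvg_at_right_filter; apply: cvgMr; exact: continuous_expR_lin.
- by move=> x _; rewrite derive1E; exact: derive_val.
Qed.

(* The integral of x^(s-1) / (1 + x) over (0, oo), with x = e^t and the negative
   half-line folded onto the positive one. *)
Definition beta_kernel s t := (expR (s * t) + expR ((1 - s) * t)) / (1 + expR t).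

Definition beta s : \bar R :=
  (\int[mu]_(t in `[0%R, +oo[) (beta_kernel s t)%:E)%E.

Lemma beta_kernel_ge0 s t : 0 <= beta_kernel s t.
Proof. by rewrite divr_ge0// addr_ge0 ?expR_ge0. Qed.

Lemma continuous_beta_kernel s : continuous (beta_kernel s).
Proof.
move=> t; apply: cvgM.
  by apply: cvgD; exact: continuous_expR_lin.
apply: cvgV; first by rewrite gt_eqF// ltr_pwDl ?expR_ge0.
by apply: cvgD; [exact: cvg_cst|exact: continuous_expR].
Qed.

Lemma measurable_beta_kernel (D : set R) s : measurable_fun D (fun t => (beta_kernel s t)%:E).
Proof.
apply/measurable_EFinP; apply: measurable_funTS.
by apply: continuous_measurable_fun; exact: continuous_beta_kernel.
Qed.

Lemma measurable_expR_lin (D : set R) c :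
  measurable_fun D (fun t => (expR (c * t))%:E).
Proof.
apply/measurable_EFinP; apply: measurable_funTS.
by apply: continuous_measurable_fun; exact: continuous_expR_lin.
Qed.

Lemma betaC s : beta (1 - s) = beta s.
Proof.
by apply: eq_integral => t _; rewrite /beta_kernel subKr [X in X / _]addrC.
Qed.

(* With y = e^t this is (1 - y + y^2) / (1 + y^3) = 1 / (1 + y). *)
Lemma beta_kernel_triplication s t :
  beta_kernel (s / 3) (3 * t) + beta_kernel ((s + 2) / 3) (3 * t) =
  beta_kernel s t + beta_kernel ((s + 1) / 3) (3 * t).
Proof.
rewrite /beta_kernel.
set y := expR t; set p := expR (s * t); set q := expR ((1 - s) * t).
have y0 : 0 < y by exact: expR_gt0.
have e1 : s / 3 * (3 * t) = s * t by field.
have e2 : (1 - s / 3) * (3 * t) = (1 - s) * t + t + t by field.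
have e3 : (s + 2) / 3 * (3 * t) = s * t + t + t by field.
have e4 : (1 - (s + 2) / 3) * (3 * t) = (1 - s) * t by field.
have e5 : (s + 1) / 3 * (3 * t) = s * t + t by field.
have e6 : (1 - (s + 1) / 3) * (3 * t) = (1 - s) * t + t by field.
have e7 : 3 * t = t + t + t by ring.
rewrite e1 e2 e3 e4 e5 e6 e7 !expRD -/y -/p -/q.
have yyy : 0 < 1 + y * y * y by rewrite addr_gt0// !mulr_gt0.
by field; rewrite !gt_eqF// addr_gt0.
Qed.

Lemma measurable_beta_kernel3 (D : set R) s :
  measurable_fun D (fun t => (beta_kernel s (3 * t))%:E).
Proof.
apply/measurable_EFinP; apply: measurable_funTS.
apply: continuous_measurable_fun => t.
apply: continuous_comp; last exact: continuous_beta_kernel.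
by apply: cvgMr; exact: cvg_id.
Qed.

Lemma beta_scale3 s :
  beta s = (3%:E * \int[mu]_(t in `[0%R, +oo[) (beta_kernel s (3 * t))%:E)%E.
Proof.
have d3 t : is_derive t 1 (fun x : R => 3 * x) 3.
  by apply: is_derive_eq; rewrite /GRing.scale/= mulr1.
have d3E : derive1 (fun x : R => 3 * x) = fun=> 3.
  by apply/funext => t; rewrite derive1E; apply: derive_val.
have := @increasing_ge0_integration_by_substitutiony R (fun x => 3 * x)
  (beta_kernel s) 0.
rewrite mulr0 d3E => H.
rewrite /beta H.
- rewrite -ge0_integralZl//=.
  + by apply: eq_integral => t _; rewrite fctE /= mulrC EFinM.
  + exact: measurable_beta_kernel3.
  + by move=> *; rewrite lee_fin beta_kernel_ge0.
- by move=> x y _ _ xy; rewrite ltr_pM2l.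
- by move=> x _; exact: cvg_cst.
- exact: is_cvg_cst.
- exact: is_cvg_cst.
- split; first by move=> x _; exact: ex_derive.
  by apply: cvg_at_right_filter; apply: cvgMr; exact: cvg_id.
- exact: gt0_cvgMry.
- exact/continuous_subspaceT/continuous_beta_kernel.
- by move=> x _; exact: beta_kernel_ge0.
Qed.

(** The pointwise identity integrated: rescaling gives a factor 3 to every term taken at 3t, which
    leaves the coefficient 3 on [beta s]. Only sums occur, so the relation makes sense before
    finiteness is known. *)
Lemma beta_triplication s :
  (beta (s / 3) + beta ((s + 2) / 3) = 3%:E * beta s + beta ((s + 1) / 3))%E.
Proof.
have p3 c t : (0 <= (beta_kernel c (3 * t))%:E)%E.
  by rewrite lee_fin beta_kernel_ge0.
have p1 c t : (0 <= (beta_kernel c t)%:E)%E by rewrite lee_fin beta_kernel_ge0.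
rewrite (beta_scale3 (s / 3)) (beta_scale3 ((s + 2) / 3)) (beta_scale3 ((s + 1) / 3)).
have I0 c : (0 <= \int[mu]_(t in `[0%R, +oo[) (beta_kernel c (3 * t))%:E)%E.
  by apply: integral_ge0.
have B0 : (0 <= beta s)%E by apply: integral_ge0.
rewrite -ge0_muleDr; [|exact: I0..].
rewrite -ge0_muleDr; [congr (_ * _)%E|exact: B0|exact: I0].
rewrite /beta -(@ge0_integralD _ _ _ mu _ (measurable_itv _) _ _ (fun t _ => p3 _ t)
  (measurable_beta_kernel3 _) (fun t _ => p3 _ t) (measurable_beta_kernel3 _)).
rewrite -(@ge0_integralD _ _ _ mu _ (measurable_itv _) _ _ (fun t _ => p1 _ t)
  (measurable_beta_kernel _) (fun t _ => p3 _ t) (measurable_beta_kernel3 _)).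
by apply: eq_integral => t _; rewrite -!EFinD beta_kernel_triplication.
Qed.

Lemma beta_ge s : 0 < s -> ((s^-1)%:E <= beta s)%E.
Proof.
move=> s0; rewrite -integral_expRN//; apply: ge0_le_integral => //.
- exact: measurable_expR_lin.
- exact: measurable_beta_kernel.
move=> t /=; rewrite in_itv/= andbT => t0.
rewrite lee_fin /beta_kernel ler_pdivlMr ?addr_gt0 ?expR_gt0//.
have -> : (1 - s) * t = - s * t + t by ring.
rewrite expRD mulrDr mulr1 lerD2r ler_expR; nra.
Qed.

(** The kernel is (e^(-st) + e^(-(1-s)t)) / (1 + e^(-t)); keeping the correction e^(-(1+s)t) of the
    geometric expansion gives the third term. That term matters: (1-s)^-1 - (1+s)^-1 is O(s), so
    [beta s - s^-1] vanishes linearly at 0, as the uniqueness argument requires. *)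
Lemma beta_le s : 0 < s < 1 ->
  (beta s <= (s^-1 + (1 - s)^-1 - (1 + s)^-1)%:E)%E.
Proof.
move=> /andP[s0 s1]; rewrite EFinB leeBrDr//.
rewrite EFinD -!integral_expRN; [|lra..].
have e0 c t : (0 <= (expR (c * t))%:E)%E by rewrite lee_fin expR_ge0.
have p1 c t : (0 <= (beta_kernel c t)%:E)%E by rewrite lee_fin beta_kernel_ge0.
rewrite /beta -(@ge0_integralD _ _ _ mu _ (measurable_itv _) _ _ (fun t _ => p1 _ t)
  (measurable_beta_kernel _) (fun t _ => e0 _ t) (measurable_expR_lin _)).
rewrite -(@ge0_integralD _ _ _ mu _ (measurable_itv _) _ _ (fun t _ => e0 _ t)
  (measurable_expR_lin _) (fun t _ => e0 _ t) (measurable_expR_lin _)).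
apply: ge0_le_integral => //.
- by move=> *; rewrite -EFinD lee_fin addr_ge0 ?beta_kernel_ge0 ?expR_ge0.
- by apply: emeasurable_funD; [exact: measurable_beta_kernel|exact: measurable_expR_lin].
- by apply: emeasurable_funD; exact: measurable_expR_lin.
move=> t /=; rewrite in_itv/= andbT => t0.
rewrite -!EFinD lee_fin /beta_kernel.
have -> : (1 - s) * t = - s * t + t by ring.
have -> : - (1 + s) * t = - s * t - t by ring.
have -> : - (1 - s) * t = s * t - t by ring.
rewrite !expRD expRN.
have y0 := expR_gt0 t; have p0 := expR_gt0 (s * t).
have : expR (- s * t) <= expR (s * t) by rewrite ler_expR; nra.
move: (expR t) (expR (s * t)) (expR (- s * t)) y0 p0 => y p q y0 p0 qp.
have y1 : 0 < 1 + y by lra.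
rewrite -(ler_pM2r y1) -(ler_pM2r y0).
have -> : ((p + q * y) / (1 + y) + q / y) * (1 + y) * y =
  (p + q * y) * y + q * (1 + y) by field; rewrite !gt_eqF.
have -> : (q + p / y) * (1 + y) * y = q * y * (1 + y) + p * (1 + y).
  by field; rewrite gt_eqF.
nra.
Qed.

Lemma beta_fin s : 0 < s < 1 -> beta s \is a fin_num.
Proof.
move=> s01; rewrite ge0_fin_numE; first exact: le_lt_trans (beta_le s01) (ltry _).
by apply: integral_ge0 => t _; rewrite lee_fin beta_kernel_ge0.
Qed.

Lemma fine_beta_bounds s : 0 < s < 1 ->
  s^-1 <= fine (beta s) <= s^-1 + (1 - s)^-1 - (1 + s)^-1.
Proof.
move=> s01; have /andP[s0 s1] := s01.
by rewrite -!lee_fin fineK ?beta_fin// beta_ge// beta_le.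
Qed.

(* The integral and the cosecant satisfy the same three-term relation and have
   the same pole at 0. *)
Lemma beta_reflection s : 0 < s < 1 -> beta s = (pi / sin (pi * s))%:E.
Proof.
have alg (a b c d p q r t : R) : a + c = 3 * d + b -> 3 * t = p - q + r ->
  3 * (d - t) = (a - p) - (b - q) + (c - r) by lra.
move=> s01; rewrite -(fineK (beta_fin s01)); congr EFin.
pose f (x : R) := fine (beta x) - pi / sin (pi * x).
apply/eqP; rewrite -subr_eq0 -/(f s); apply/eqP; move: s s01.
have f_sym x : f (1 - x) = f x.
  by rewrite /f betaC mulrBr mulr1 sinB sinpi cospi mul0r sub0r mulN1r opprK.
have f_small (x : R) : 0 < x <= 1 / 4 -> `|f x| <= 16 * x.
  move=> x14; have x01 : 0 < x < 1 by lra.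
  have /andP[x0 x4] := x14.
  have /andP[b1 b2] := fine_beta_bounds x01.
  have c1 := cosec_ge x01; have c2 := cosec_le x14.
  have b3 : (1 - x)^-1 - (1 + x)^-1 <= 16 * x.
    have -> : (1 - x)^-1 - (1 + x)^-1 = 2 * x / (1 - x ^+ 2).
      by field; rewrite !gt_eqF//; nra.
    rewrite ler_pdivrMr; nra.
  by rewrite ler_norml /f; lra.
(* On (1/4, 1/2] the reciprocals x^-1 and (1-x)^-1 are at most 4 and 2, and the cosecant is
   decreasing. The symmetry under x -> 1 - x covers the other half. *)
pose M := 6 + pi / sin (pi * (1 / 4) : R).
have M0 : 0 <= pi / sin (pi * (1 / 4) : R).
  have p0 := @pi_gt0 R.
  by rewrite divr_ge0 ?pi_ge0//; apply: sin_ge0_pi; lra.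
have f_bounded_half (x : R) : 0 < x <= 1 / 2 -> `|f x| <= M.
  move=> x12; have [x4|x4] := leP x (1 / 4).
    by apply: (le_trans (f_small x _)); rewrite /M; lra.
  have x01 : 0 < x < 1 by lra.
  have p0 := @pi_gt0 R.
  have /andP[b1 b2] := fine_beta_bounds x01.
  have s4 : 0 < sin (pi * (1 / 4) : R) by apply: sin_gt0_pi; lra.
  have sx : 0 < sin (pi * x) by apply: sin_gt0_pi; nra.
  have c1 := cosec_ge x01.
  have c2 : pi / sin (pi * x) <= pi / sin (pi * (1 / 4)).
    rewrite ler_pM2l// lef_pV2 ?posrE// ltW// ltr_sin ?in_itv/=; nra.
  have i1 : x^-1 <= 4 by rewrite -[4]invrK lef_pV2 ?posrE; lra.
  have i2 : (1 - x)^-1 <= 2 by rewrite -[2]invrK lef_pV2 ?posrE; lra.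
  have i3 : 0 <= (1 + x)^-1 by rewrite invr_ge0; lra.
  have i4 : 0 <= x^-1 by rewrite invr_ge0; lra.
  by rewrite ler_norml /f /M; lra.
apply: (@three_term_eq0 _ f M 16) => // x x01.
- have e := beta_triplication x.
  have b0 : 0 < x / 3 < 1 by lra.
  have b1 : 0 < (x + 1) / 3 < 1 by lra.
  have b2 : 0 < (x + 2) / 3 < 1 by lra.
  move: e; rewrite -(fineK (beta_fin b0)) -(fineK (beta_fin b1)).
  rewrite -(fineK (beta_fin b2)) -(fineK (beta_fin x01)).
  rewrite -EFinM -!EFinD => -[e].
  exact: alg e (cosec_triplication x01).
- have [x12|x12] := leP x (1 / 2); first by apply: f_bounded_half; lra.
  by rewrite -f_sym; apply: f_bounded_half; lra.
Qed.

End BetaIntegral.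

(** * Change of variables and the total integral of the kernel *)

Section KernelIntegral.
Context {R : realType}.
Notation mu := (@lebesgue_measure R).

(** Substitution on the compact intervals [-k, k] followed by monotone convergence on both sides.
    The hypotheses on the range of [phi] say that the images [phi(-k), phi(k)] exhaust (r, +oo). *)
Lemma ge0_integral_increasing_reparametrization (phi dphi G : R -> R) (r : R) :
  (forall t, is_derive t (1 : R) phi (dphi t)) -> continuous dphi ->
  (forall t, 0 <= dphi t) -> {homo phi : x y / x < y} ->
  (forall t, r < phi t) ->
  (forall y, r < y -> exists k : nat, phi (- k%:R) <= y <= phi k%:R) ->
  {in `]r, +oo[, continuous G} -> (forall y, r < y -> 0 <= G y) ->
  (\int[mu]_(y in `]r, +oo[) (G y)%:E = \int[mu]_t (G (phi t) * dphi t)%:E)%E.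
Proof.
move=> phiD cdphi dphi0 phiI phir phi_cover cG G0.
have cphi : continuous phi.
  move=> t; apply: differentiable_continuous; apply/derivable1_diffP.
  by have [] := phiD t.
have phi_le x y : x <= y -> phi x <= phi y.
  by rewrite le_eqVlt => /predU1P[->//|/phiI/ltW].
have dphiE : derive1 phi = dphi.
  by apply/funext => t; rewrite derive1E; have [_ ->] := phiD t.
pose J (k : nat) : set R := `[phi (- k%:R), phi k%:R]%classic.
pose I (k : nat) : set R := `[- k%:R, k%:R]%classic.
have JE : \bigcup_k J k = `]r, +oo[%classic.
  apply/seteqP; split => [y [k _]|y]; rewrite /J /= !in_itv/=.
    by move=> /andP[+ _]; rewrite andbT; exact: lt_le_trans (phir _).
  by rewrite andbT => /phi_cover[k ky]; exists k => //=; rewrite in_itv.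
have IE : \bigcup_k I k = [set: R] by rewrite -(bigcup_itvT true false).
have mG : measurable_fun `]r, +oo[%classic G.
  apply: open_continuous_measurable_fun; first exact: interval_open.
  by move=> y; rewrite inE => ry; apply: cG.
have cGphi : continuous (fun t => G (phi t) * dphi t).
  move=> t; apply: cvgM; last exact: cdphi.
  apply: continuous_comp; first exact: cphi.
  by apply: cG; rewrite in_itv/= phir.
have lhs : (\int[mu]_(y in J k) (G y)%:E)%E @[k --> \oo] -->
    (\int[mu]_(y in `]r, +oo[) (G y)%:E)%E.
  rewrite -JE; apply: ge0_nondecreasing_set_cvg_integral.
  - move=> n m nm; apply/subsetPset => y; rewrite /J /= !in_itv/= => /andP[h1 h2].
    rewrite (le_trans _ h1) ?(le_trans h2)// phi_le// ?lerN2 ler_nat//.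
  - by move=> k; exact: measurable_itv.
  - move=> k; apply/measurable_EFinP; apply: measurable_funS mG; first exact: measurable_itv.
    by rewrite -JE; exact: bigcup_sup.
  - move=> k y; rewrite /J /= in_itv/= => /andP[h _].
    by rewrite lee_fin G0// (lt_le_trans _ h).
have rhs : (\int[mu]_(t in I k) (G (phi t) * dphi t)%:E)%E @[k --> \oo] -->
    (\int[mu]_t (G (phi t) * dphi t)%:E)%E.
  rewrite -IE; apply: ge0_nondecreasing_set_cvg_integral.
  - move=> n m nm; apply/subsetPset => y; rewrite /I /= !in_itv/= => /andP[h1 h2].
    by rewrite (le_trans _ h1) ?(le_trans h2)// ?lerN2 ler_nat.
  - by move=> k; exact: measurable_itv.
  - move=> k; apply/measurable_EFinP; apply: measurable_funTS.
    by apply: continuous_measurable_fun; exact: cGphi.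
  - by move=> k t _; rewrite lee_fin mulr_ge0// G0.
apply: cvg_unique lhs _; first exact: ereal_hausdorff.
apply: cvg_trans rhs; apply: near_eq_cvg; near=> k.
rewrite /J /I (@integration_by_substitution_increasing _ phi G (- k%:R) k%:R).
- by rewrite dphiE.
- by rewrite (@le_trans _ _ 0)// oppr_le0.
- by move=> x y _ _; exact: phiI.
- by rewrite dphiE => t _; exact: cdphi.
- rewrite dphiE; apply/cvg_ex; exists (dphi (- k%:R)).
  by apply: cvg_at_right_filter; exact: cdphi.
- rewrite dphiE; apply/cvg_ex; exists (dphi k%:R).
  by apply: cvg_at_left_filter; exact: cdphi.
- split; first by move=> t _; have [] := phiD t.
    by apply: cvg_at_right_filter; exact: cphi.
  by apply: cvg_at_left_filter; exact: cphi.
- apply: continuous_in_subspaceT => y; rewrite inE/= in_itv/= => /andP[h _].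
  by apply: cG; rewrite in_itv/= (lt_le_trans (phir _) h).
Unshelve. all: by end_near. Qed.

(** Reflecting t swaps the exponents 1 - s and s, so the negative half-line supplies the other
    summand of [beta_kernel]. *)
Lemma integral_logistic s :
  (\int[mu]_t (expR ((1 - s) * t) / (1 + expR t))%:E = beta s)%E.
Proof.
pose g c t : R := expR (c * t) / (1 + expR t).
have g0 c t : (0 <= (g c t)%:E)%E by rewrite lee_fin divr_ge0// ?addr_ge0 ?expR_ge0.
have cg c : continuous (g c).
  move=> t; apply: cvgM; first exact: continuous_expR_lin.
  apply: cvgV; first by rewrite gt_eqF// ltr_pwDl ?expR_ge0.
  by apply: cvgD; [exact: cvg_cst|exact: continuous_expR].
have mg c (D : set R) : measurable_fun D (fun t => (g c t)%:E).
  apply/measurable_EFinP; apply: measurable_funTS.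
  by apply: continuous_measurable_fun; exact: cg.
rewrite -(itv_setU_setT false (0 : R)).
have -> : (fun t => (expR ((1 - s) * t) / (1 + expR t))%:E) =
  (fun t => (g (1 - s) t)%:E) by [].
rewrite (@ge0_integral_setU _ _ _ mu `]-oo, 0] `]0, +oo[)//;
  first [exact: mg|rewrite integral_itv_obnd_cbnd; last exact: mg|idtac]; last first.
  rewrite disj_set2E; apply/eqP/seteqP; split => // t [] /=.
  by rewrite !in_itv/= andbT => /le_lt_trans h /h; rewrite ltxx.
have -> : (\int[mu]_(t in `]-oo, 0%R]) (g (1 - s) t)%:E =
           \int[mu]_(t in `[0%R, +oo[) (g s t)%:E)%E.
  rewrite ge0_integration_by_substitution0; [|exact: mg|by []].
  apply: eq_integral => t _; congr EFin; rewrite /g.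
  have -> : (1 - s) * t = s * - t + t by ring.
  rewrite expRD !expRN; have := expR_gt0 t; have := expR_gt0 (s * - t).
  move: (expR _) (expR _) => p q p0 q0.
  by field; rewrite !gt_eqF// addr_gt0.
rewrite -(@ge0_integralD _ _ _ mu _ (measurable_itv _) _ _ (fun t _ => g0 _ t)
  (mg _ _) (fun t _ => g0 _ t) (mg _ _)).
by apply: eq_integral => t _; rewrite -EFinD /beta_kernel mulrDl.
Qed.

(* The kernel of M_r; at r = 0 it is rho^(-1-2s), the kernel of L. *)
Definition kern (s r x : R) : R := ((x ^+ 2 - r ^+ 2) `^ s * x)^-1.

Lemma kern_ge0 s r x : 0 <= x -> 0 <= kern s r x.
Proof. by move=> x0; rewrite invr_ge0 mulr_ge0// powR_ge0. Qed.

Lemma continuous_kern s r : 0 <= r -> {in `]r, +oo[, continuous (kern s r)}.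
Proof.
move=> r0 x; rewrite in_itv/= andbT => rx.
have x0 : 0 < x by exact: le_lt_trans rx.
have xr : 0 < x ^+ 2 - r ^+ 2 by rewrite subr_gt0 ltr_pXn2r// nnegrE// ltW.
apply: cvgV; first by rewrite mulf_neq0 ?gt_eqF ?powR_gt0.
apply: cvgM; last exact: cvg_id.
apply: (@continuous_comp _ _ _ (fun x : R => x ^+ 2 - r ^+ 2) (fun y => y `^ s)).
  by apply: cvgB; [exact: exprn_continuous|exact: cvg_cst].
apply: differentiable_continuous; apply/derivable1_diffP.
by have [] := is_derive1_powR s xr.
Qed.

Lemma measurable_kern s r : 0 <= r -> measurable_fun (`]r, +oo[%classic : set R) (kern s r).
Proof.
move=> r0; apply: open_continuous_measurable_fun; first exact: interval_open.
by move=> x; rewrite inE => rx; exact: continuous_kern.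
Qed.

(* The substitution x = r sqrt(1 + e^t) turns the kernel into the logistic
   density. *)
Lemma integral_kern s r : 0 < s < 1 -> 0 < r ->
  (\int[mu]_(x in `]r, +oo[) (kern s r x)%:E =
   (pi / sin (pi * s) / (2 * r `^ (2 * s)))%:E)%E.
Proof.
move=> s01 r0.
pose w t : R := Num.sqrt (1 + expR t).
have e1 t : 0 < 1 + expR t :> R by rewrite addr_gt0 ?expR_gt0.
have w0 t : 0 < w t by rewrite sqrtr_gt0.
have w2 t : w t ^+ 2 = 1 + expR t by rewrite sqr_sqrtr// ltW.
have cw : continuous w.
  move=> t; apply: continuous_comp; last exact: sqrt_continuous.
  by apply: cvgD; [exact: cvg_cst|exact: continuous_expR].
have phiD t : is_derive t (1 : R) (fun t => r * w t) (r * (expR t / (2 * w t))).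
  have ds := is_derive1_sqrt (e1 t).
  have de : is_derive t (1 : R) (fun x : R => 1 + expR x) (expR t).
    by rewrite -[expR t]add0r; exact: is_deriveD (is_derive_cst _ _ _) (is_derive_expR t).
  have dw : is_derive t (1 : R) w ((2 * w t)^-1 * expR t).
    exact: (@is_derive1_comp _ _ (fun x : R => 1 + expR x) _ _ _ ds de).
  by rewrite (mulrC (expR t)); exact: is_deriveZ dw.
rewrite (@ge0_integral_increasing_reparametrization (fun t => r * w t)
  (fun t => r * (expR t / (2 * w t))) _ _ phiD); first last.
- by move=> y ry; rewrite kern_ge0// ltW// (lt_trans r0).
- by apply: continuous_kern; exact: ltW.
- move=> y ry.
  (* The preimage of [y] under r sqrt(1 + e^t) is ln((y/r)^2 - 1), so an integer above its absolute
     value gives the required interval. *)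
  have z0 : 0 < (y / r) ^+ 2 - 1.
    by rewrite subr_gt0 expr_gt1 ?divr_ge0 ?(ltW r0)// ?ltr_pdivlMr ?mul1r// ltW// (lt_trans r0).
  pose k := Num.truncn `|ln ((y / r) ^+ 2 - 1)|; exists k.+1.
  have yE : y = r * Num.sqrt (1 + ((y / r) ^+ 2 - 1)).
    rewrite addrC subrK sqrtr_sqr ger0_norm ?divr_ge0 ?(ltW r0)//.
      by rewrite mulrC divfK ?gt_eqF.
    by rewrite ltW// (lt_trans r0).
  have : `|ln ((y / r) ^+ 2 - 1)| <= k.+1%:R by rewrite ltW// truncnS_gt.
  rewrite ler_norml => /andP[l1 l2].
  have a1 : expR (- k.+1%:R) <= (y / r) ^+ 2 - 1 by rewrite -[leRHS]lnK// ler_expR.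
  have a2 : (y / r) ^+ 2 - 1 <= expR k.+1%:R by rewrite -[leLHS]lnK// ler_expR.
  rewrite [X in _ <= X <= _]yE !ler_pM2l//; apply/andP.
  by split; apply: ler_wsqrtr; rewrite lerD2l.
- move=> t; rewrite -[ltLHS]mulr1 ltr_pM2l// -sqrtr1 ltr_sqrt//.
  by rewrite ltrDl expR_gt0.
- by move=> x y xy; rewrite ltr_pM2l// ltr_sqrt// ltrD2l ltr_expR.
- by move=> t; rewrite mulr_ge0 ?(ltW r0)// divr_ge0 ?expR_ge0// mulr_ge0// ltW.
- move=> t; apply: cvgMr; apply: cvgM; first exact: continuous_expR.
  apply: cvgV; first by rewrite mulf_neq0// gt_eqF.
  by apply: cvgMr; exact: cw.
have rs0 : 0 < r `^ (2 * s) by rewrite powR_gt0.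
transitivity ((\int[mu]_t ((2 * r `^ (2 * s))^-1%:E *
    (expR ((1 - s) * t) / (1 + expR t))%:E))%E).
  apply: eq_integral => t _; rewrite -EFinM; congr EFin.
  rewrite /kern exprMn w2 -[X in _ - X]mulr1 -mulrBr addrAC subrr add0r.
  rewrite powRM ?expR_ge0 ?exprn_ge0 ?(ltW r0)//.
  rewrite -powR_mulrn ?(ltW r0)// -powRrM -expRM.
  have -> : (1 - s) * t = t - s * t by ring.
  rewrite expRD expRN -w2 (mulrC t s).
  have := expR_gt0 (s * t); have := w0 t.
  move: (expR (s * t)) (expR t) (w t) rs0 => p q y rs0 y0 p0.
  by field; rewrite !gt_eqF.
have k0 : (0 <= ((2 * r `^ (2 * s))^-1)%:E)%E by rewrite lee_fin invr_ge0 mulr_ge0// ltW.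
rewrite ge0_integralZl//.
- by rewrite integral_logistic (beta_reflection s01) -EFinM mulrC.
- apply/measurable_EFinP; apply: continuous_measurable_fun => t.
  apply: cvgM; first exact: continuous_expR_lin.
  apply: cvgV; first by rewrite gt_eqF.
  by apply: cvgD; [exact: cvg_cst|exact: continuous_expR].
Qed.

End KernelIntegral.

(** * Comparison of the kernels *)

Section KernelEstimates.
Context {R : realType}.
Notation mu := (@lebesgue_measure R).

(** The integrands to come may blow up at an end point, so the fundamental theorem is used on inner
    compact intervals, and a bound on the increments of [F] replaces its boundary values. *)
Lemma ge0_integral_oo_le (f F : R -> R) (a b C : R) : a < b ->
  {in `]a, b[, continuous f} -> {in `]a, b[, forall x, 0 <= f x} ->
  {in `]a, b[, forall x, is_derive x (1 : R) F (f x)} ->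
  (forall c d, a < c -> c < d -> d < b -> F d - F c <= C) ->
  (\int[mu]_(x in `]a, b[) (f x)%:E <= C%:E)%E.
Proof.
move=> ab cf f0 dF FC.
(* The shift by 3 makes [e k] at most a third of the length, so that [a + e k, b - e k] is
   nondegenerate for every k. *)
pose e (k : nat) : R := (b - a) / (k%:R + 3).
have k3 (k : nat) : 0 < k%:R + 3 :> R by rewrite ltr_wpDl.
have ba0 : 0 < b - a by rewrite subr_gt0.
have e0 k : 0 < e k by rewrite divr_gt0.
have e3 k : e k <= (b - a) / 3.
  by rewrite ler_wpM2l ?(ltW ba0)// lef_pV2 ?posrE// lerDr.
pose I (k : nat) : set R := `[a + e k, b - e k]%classic.
have Iab k x : I k x -> a < x < b.
  rewrite /I/= in_itv/= => /andP[h1 h2]; have := e0 k => ek0.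
  by apply/andP; split; lra.
have IE : \bigcup_k I k = `]a, b[%classic.
  apply/seteqP; split => [x [k _ /Iab]|x]; rewrite /= in_itv//=.
  move=> /andP[ax xb].
  pose m := Num.min (x - a) (b - x).
  have m0 : 0 < m by rewrite lt_min !subr_gt0 ax.
  pose k := Num.truncn ((b - a) / m).
  exists k.+1 => //; rewrite /I/= in_itv/=.
  have ek : e k.+1 <= m.
    rewrite /e ler_pdivrMr// mulrC -ler_pdivrMr//.
    have h : (b - a) / m <= k.+1%:R by rewrite ltW// truncnS_gt.
    lra.
  by move: ek; rewrite le_min => /andP[]; lra.
have mf : measurable_fun (`]a, b[%classic : set R) f.
  apply: open_continuous_measurable_fun; first exact: interval_open.
  by move=> x; rewrite inE => xab; exact: cf.
have lim : (\int[mu]_(x in I k) (f x)%:E)%E @[k --> \oo] -->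
    (\int[mu]_(x in `]a, b[) (f x)%:E)%E.
  rewrite -IE; apply: ge0_nondecreasing_set_cvg_integral.
  - move=> n m nm; apply/subsetPset => x; rewrite /I /= !in_itv/= => /andP[h1 h2].
    have : e m <= e n by rewrite ler_wpM2l ?(ltW ba0)// lef_pV2 ?posrE// lerD2r ler_nat.
    by move=> h; apply/andP; split; lra.
  - by move=> k; exact: measurable_itv.
  - move=> k; apply/measurable_EFinP; apply: measurable_funS mf; first exact: measurable_itv.
    by rewrite -IE; exact: bigcup_sup.
  - by move=> k x /Iab xab; rewrite lee_fin f0// in_itv.
rewrite -(cvg_lim (@ereal_hausdorff R) lim).
apply: lime_le; first by apply/cvg_ex; eexists; exact: lim.
near=> k; rewrite /I (@continuous_FTC2 _ f F).
- by rewrite -EFinB lee_fin FC//; have := e0 k; have := e3 k; lra.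
- by have := e3 k; lra.
- by apply: continuous_in_subspaceT => x; rewrite inE => /Iab xab; apply: cf; rewrite in_itv.
- have cF x : a < x < b -> F y @[y --> x] --> F x.
    move=> xab; apply: differentiable_continuous; apply/derivable1_diffP.
    have xI : x \in `]a, b[ by rewrite in_itv.
    by have [] := dF x xI.
  have := e0 k; have := e3 k => h1 h2.
  split; first 1 last.
  + by apply: cvg_at_right_filter; apply: cF; lra.
  + by apply: cvg_at_left_filter; apply: cF; lra.
  move=> x; rewrite in_itv/= => xI.
  have xab : x \in `]a, b[ by rewrite in_itv/=; lra.
  by have [] := dF x xab.
- move=> x; rewrite in_itv/= => xI; have := e0 k => ek0.
  have xab : x \in `]a, b[ by rewrite in_itv/=; lra.
  by rewrite derive1E; have [_ ->] := dF x xab.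
Unshelve. all: by end_near. Qed.

Lemma ge0_integral_itvoy_split (f : R -> \bar R) (a c : R) : a < c ->
  measurable_fun (`]a, +oo[%classic : set R) f ->
  (forall x, a < x -> (0 <= f x)%E) ->
  (\int[mu]_(x in `]a, +oo[) f x =
   \int[mu]_(x in `]a, c[) f x + \int[mu]_(x in `]c, +oo[) f x)%E.
Proof.
move=> ac mf f0.
have mfc : measurable_fun (`]c, +oo[%classic : set R) f.
  apply: measurable_funS mf; first exact: measurable_itv.
  by move=> x; rewrite /= !in_itv/= !andbT; exact: lt_trans.
have E : (`]a, +oo[%classic : set R) = `]a, c[%classic `|` `[c, +oo[%classic.
  apply/seteqP; split => x; rewrite /= !in_itv/= ?andbT.
    by move=> ax; case: (ltP x c) => xc; [left; rewrite ax|right].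
  by move=> [/andP[]//|]; exact: lt_le_trans.
rewrite (integral_itv_obnd_cbnd mfc) E ge0_integral_setU//.
- by rewrite -E.
- move=> x [|]; rewrite /= in_itv/= ?andbT.
    by move=> /andP[ax _]; exact: f0.
  by move=> cx; apply: f0; exact: lt_le_trans cx.
- rewrite disj_set2E; apply/eqP/seteqP; split => // x [] /=.
  by rewrite !in_itv/= andbT => /andP[_ xc]; rewrite leNgt xc.
Qed.

Variable s : R.

(** The integral of x^2 k_0(x) = x^(1-2s) over (0, r), that is r^(2-2s) / (2 - 2s). The same
    quantity bounds the effect of replacing k_0 by k_r beyond r. *)
Definition kern_gap (r : R) : R := (r ^+ 2) `^ (1 - s) / (2 * (1 - s)).

Definition kern_primitive (r x : R) : R := (x ^+ 2 - r ^+ 2) `^ (1 - s) / (2 * (1 - s)).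

Lemma sqr_sub_gt0 (r x : R) : 0 <= r < x -> 0 < x ^+ 2 - r ^+ 2.
Proof.
by move=> /andP[r0 rx]; rewrite subr_gt0 ltr_pXn2r// nnegrE ltW// (le_lt_trans r0).
Qed.

Lemma is_derive_kern_primitive (r x : R) : 0 < s < 1 ->
  0 <= r < x ->
  is_derive x (1 : R) (kern_primitive r) (x ^+ 2 * kern s r x).
Proof.
move=> s01 rx; have z0 := sqr_sub_gt0 rx; have /andP[r0 rx'] := rx.
have s1 : 0 < 1 - s by lra.
have x0 : 0 < x by exact: le_lt_trans rx'.
have dz : is_derive x (1 : R) (fun y : R => y ^+ 2 - r ^+ 2) (2 * x).
  by apply: is_derive_eq; rewrite /GRing.scale/=; ring.
have dp := @is_derive1_comp _ (fun y => y `^ (1 - s)) (fun y : R => y ^+ 2 - r ^+ 2)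
  _ _ _ (is_derive1_powR (1 - s) z0) dz.
have -> : kern_primitive r =
    (2 * (1 - s))^-1 \*: ((fun y => y `^ (1 - s)) \o (fun y : R => y ^+ 2 - r ^+ 2)).
  by apply/funext => y; rewrite /kern_primitive mulrC.
have -> : x ^+ 2 * kern s r x = (2 * (1 - s))^-1 *:
   ((1 - s) * (x ^+ 2 - r ^+ 2) `^ (1 - s - 1) * (2 * x)).
  rewrite /kern addrAC subrr add0r powRN /GRing.scale/=.
  have p0 : 0 < (x ^+ 2 - r ^+ 2) `^ s by rewrite powR_gt0.
  by field; rewrite !gt_eqF.
exact: is_deriveZ dp.
Qed.

Lemma kern_le (r x : R) : 0 < s < 1 ->
  0 <= r < x -> kern s 0 x <= kern s r x.
Proof.
move=> s01 rx; have h := sqr_sub_gt0 rx; have /andP[r0 rx'] := rx.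
have x0 : 0 < x by exact: le_lt_trans rx'.
have h0 : 0 < x ^+ 2 - 0 ^+ 2 by apply: sqr_sub_gt0; rewrite lexx.
rewrite lef_pV2 ?posrE ?mulr_gt0 ?powR_gt0//.
rewrite ler_pM2r// ge0_ler_powR ?nnegrE ?(ltW h)//; first lra.
  by rewrite ltW.
by rewrite lerB// expr0n/= exprn_ge0.
Qed.

Lemma kern_le_far (r rho x : R) : 0 < s < 1 ->
  0 < r -> r <= rho / 2 -> rho <= x ->
  kern s r x <= (1 + 2 * (r / rho) ^+ 2) * kern s 0 x.
Proof.
move=> s01 r0 rrho rhox; have rho0 : 0 < rho by lra.
have x0 : 0 < x by lra.
set t := (r / rho) ^+ 2.
have t0 : 0 <= t by rewrite exprn_ge0// divr_ge0// ltW.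
have t4 : t <= 1 / 4.
  have h : 0 <= r / rho by rewrite divr_ge0// ltW.
  have h' : r / rho <= 1 / 2 by rewrite ler_pdivrMr//; lra.
  by rewrite /t; nra.
have xt : x ^+ 2 * (1 - t) <= x ^+ 2 - r ^+ 2.
  rewrite mulrBr mulr1 lerD2l lerN2.
  have -> : r ^+ 2 = rho ^+ 2 * t by rewrite /t; field; rewrite gt_eqF.
  by rewrite ler_wpM2r// ler_pXn2r// nnegrE ltW.
have x2 : 0 < x ^+ 2 by rewrite exprn_gt0.
have p0 : 0 < (x ^+ 2) `^ s by rewrite powR_gt0.
have key : (x ^+ 2) `^ s * (1 - t) <= (x ^+ 2 - r ^+ 2) `^ s.
  apply: (@le_trans _ _ ((x ^+ 2 * (1 - t)) `^ s)).
    rewrite powRM ?(ltW x2)//; last lra.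
    rewrite ler_pM2l// -[leLHS]powRr1; last lra.
    rewrite ger_powR; lra.
  rewrite ge0_ler_powR ?nnegrE//; first lra.
    by rewrite mulr_ge0 ?(ltW x2)//; lra.
  by apply: le_trans xt; rewrite mulr_ge0 ?(ltW x2)//; lra.
rewrite /kern expr0n/= subr0.
have t1 : 0 < 1 - t by lra.
apply: (@le_trans _ _ (((x ^+ 2) `^ s * (1 - t) * x)^-1)).
  rewrite lef_pV2 ?posrE ?mulr_gt0//; first by rewrite ler_pM2r.
  by apply: lt_le_trans key; rewrite mulr_gt0.
rewrite (_ : (_ * (1 - t) * x)^-1 = (1 - t)^-1 * ((x ^+ 2) `^ s * x)^-1).
  rewrite ler_pM2r ?invr_gt0 ?mulr_gt0// -[leLHS]mul1r ler_pdivrMr//; nra.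
by field; rewrite !gt_eqF.
Qed.

(** Write (x+y)^p = x (x+y)^(p-1) + y (x+y)^(p-1); the power p - 1 <= 0 is nonincreasing. *)
Lemma powR_subadd (p x y : R) : 0 < p <= 1 -> 0 < x -> 0 < y ->
  (x + y) `^ p <= x `^ p + y `^ p.
Proof.
move=> p01 x0 y0; have xy0 : 0 < x + y by rewrite addr_gt0.
have E z : 0 < z -> z `^ p = z * z `^ (p - 1).
  move=> z0; rewrite -[X in X * _](powRr1 (ltW z0)) -powRD.
    by rewrite addrC subrK.
  by rewrite (gt_eqF z0) implybT.
have le z : 0 < z -> z <= x + y -> (x + y) `^ (p - 1) <= z `^ (p - 1).
  move=> z0 zxy; rewrite -opprB !powRN lef_pV2 ?posrE ?powR_gt0//.
  by rewrite ge0_ler_powR ?nnegrE ?(ltW z0) ?(ltW xy0)//; lra.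
rewrite E// mulrDl [X in _ <= X + _]E// [X in _ <= _ + X]E//.
by apply: lerD; rewrite ler_pM2l// le//; lra.
Qed.

Lemma continuous_sqr_kern (r : R) : 0 <= r ->
  {in `]r, +oo[, continuous (fun x : R => x ^+ 2 * kern s r x)}.
Proof.
move=> r0 x xr; apply: cvgM; first exact: exprn_continuous.
exact: continuous_kern.
Qed.

Lemma integral_sqr_kern_near (r : R) : 0 < s < 1 ->
  0 < r ->
  (\int[mu]_(x in `]0%R, r[) (x ^+ 2 * kern s 0 x)%:E <= (kern_gap r)%:E)%E.
Proof.
move=> s01 r0; apply: (ge0_integral_oo_le (F := kern_primitive 0)) => //.
- move=> x; rewrite in_itv/= => /andP[x0 _].
  by apply: continuous_sqr_kern => //; rewrite in_itv/= x0.
- move=> x; rewrite in_itv/= => /andP[x0 _].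
  by rewrite mulr_ge0 ?sqr_ge0// kern_ge0// ltW.
- by move=> x; rewrite in_itv/= => /andP[x0 _]; apply: (is_derive_kern_primitive s01); rewrite lexx.
- move=> c d c0 cd dr; rewrite /kern_primitive /kern_gap expr0n/= !subr0.
  rewrite -mulrBl ler_pM2r ?invr_gt0; last lra.
  rewrite lerBlDr ler_wpDr ?powR_ge0//.
  rewrite ge0_ler_powR ?nnegrE ?sqr_ge0//; first lra.
  by rewrite ler_pXn2r ?nnegrE ?ltW// (lt_trans c0)// (lt_trans cd).
Qed.

(** The increment of the primitive from c to d has a nonpositive contribution at d, while
    subadditivity of the power 1 - s bounds the one at c by r^(2-2s). The bound is therefore uniform
    in [rho]. *)
Lemma integral_sqr_kern_diff (r rho : R) : 0 < s < 1 ->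
  0 < r -> r < rho ->
  (\int[mu]_(x in `]r, rho[) (x ^+ 2 * (kern s r x - kern s 0 x))%:E <= (kern_gap r)%:E)%E.
Proof.
move=> s01 r0 rrho.
apply: (ge0_integral_oo_le (F := kern_primitive r - kern_primitive 0)) => //.
- move=> x; rewrite in_itv/= => /andP[rx _].
  apply: cvgM; first exact: exprn_continuous.
  apply: cvgB; apply: continuous_kern => //; rewrite ?in_itv/= ?andbT ?ltW//.
  exact: lt_trans rx.
- move=> x; rewrite in_itv/= => /andP[rx _].
  by rewrite mulr_ge0 ?sqr_ge0// subr_ge0 kern_le// (ltW r0).
- move=> x; rewrite in_itv/= => /andP[rx _]; rewrite mulrBr.
  apply: is_deriveB; apply: (is_derive_kern_primitive s01); rewrite ?lexx ?(ltW r0)//=.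
  exact: lt_trans rx.
- move=> c d rc cd dr; rewrite !fctE /kern_primitive /kern_gap expr0n/= !subr0.
  rewrite -!mulrBl ler_pM2r ?invr_gt0; last lra.
  have c0 : 0 < c ^+ 2 - r ^+ 2 by apply: sqr_sub_gt0; rewrite ltW.
  have d0 : 0 < d ^+ 2 - r ^+ 2 by apply: sqr_sub_gt0; rewrite ltW//= (lt_trans rc).
  have p1 : 0 < 1 - s <= 1 by lra.
  have := powR_subadd p1 c0 (exprn_gt0 2 r0); rewrite subrK => h1.
  have h2 : (d ^+ 2 - r ^+ 2) `^ (1 - s) <= (d ^+ 2) `^ (1 - s).
    rewrite ge0_ler_powR ?nnegrE ?sqr_ge0 ?(ltW d0)//; first lra.
    by rewrite gerBl sqr_ge0.
  lra.
Qed.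

End KernelEstimates.

(** * Half-line integrals against the two kernels *)

Section OneDimensional.
Context {R : realType}.
Notation mu := (@lebesgue_measure R).

(** The integral of [q] may be +oo, so the difference need not be integrable. Its positive and
    negative parts satisfy fp + q = fm + p, an identity between nonnegative functions, and fp <= p
    keeps the first part finite. *)
Lemma integral_sub_ge0 d (T : measurableType d) (nu : {measure set T -> \bar R})
    (D : set T) (p q : T -> R) : measurable D ->
  measurable_fun D p -> measurable_fun D q ->
  (forall x, D x -> 0 <= p x) -> (forall x, D x -> 0 <= q x) ->
  (\int[nu]_(x in D) (p x)%:E < +oo)%E ->
  (\int[nu]_(x in D) (p x - q x)%:E =
   \int[nu]_(x in D) (p x)%:E - \int[nu]_(x in D) (q x)%:E)%E.
Proof.
move=> mD mp mq p0 q0 pfin.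
pose fp x := Num.max (p x - q x) 0; pose fm x := Num.max (q x - p x) 0.
have mfp : measurable_fun D fp.
  by apply: measurable_maxr => //; exact: measurable_funB.
have mfm : measurable_fun D fm.
  by apply: measurable_maxr => //; exact: measurable_funB.
have fp0 x : 0 <= fp x by rewrite le_max lexx orbT.
have fm0 x : 0 <= fm x by rewrite le_max lexx orbT.
have E : (\int[nu]_(x in D) (p x - q x)%:E =
    \int[nu]_(x in D) (fp x)%:E - \int[nu]_(x in D) (fm x)%:E)%E.
  rewrite integralE; congr (_ - _)%E; apply: eq_integral => x _.
    by rewrite funeposE -EFin_max.
  by rewrite funenegE -EFinN opprB -EFin_max.
have := @ge0_integralD _ _ _ nu D mD (fun x => (fp x)%:E) (fun x => (q x)%:E).
move=> /(_ (fun x _ => fp0 x) ltac:(exact/measurable_EFinP) q0 ltac:(exact/measurable_EFinP)).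
have := @ge0_integralD _ _ _ nu D mD (fun x => (fm x)%:E) (fun x => (p x)%:E).
move=> /(_ (fun x _ => fm0 x) ltac:(exact/measurable_EFinP) p0 ltac:(exact/measurable_EFinP)).
have -> : (\int[nu]_(x in D) ((fm x)%:E + (p x)%:E) =
           \int[nu]_(x in D) ((fp x)%:E + (q x)%:E))%E.
  apply: eq_integral => x _; rewrite -!EFinD; congr EFin; rewrite /fm /fp.
  by rewrite !maxEle; case: ifPn; case: ifPn; lra.
move=> -> H; rewrite E.
have fple : (\int[nu]_(x in D) (fp x)%:E <= \int[nu]_(x in D) (p x)%:E)%E.
  apply: ge0_le_integral => //; try exact/measurable_EFinP.
    by move=> x _; rewrite lee_fin fp0.
  by move=> x Dx; rewrite lee_fin /fp ge_max p0// andbT gerBl q0.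
have fmI0 : (0 <= \int[nu]_(x in D) (fm x)%:E)%E by apply: integral_ge0 => x _; rewrite lee_fin.
have qI0 : (0 <= \int[nu]_(x in D) (q x)%:E)%E by apply: integral_ge0 => x /q0.
have pI0 : (0 <= \int[nu]_(x in D) (p x)%:E)%E by apply: integral_ge0 => x /p0.
have fpI0 : (0 <= \int[nu]_(x in D) (fp x)%:E)%E by apply: integral_ge0 => x _; rewrite lee_fin.
move: H fple fmI0 qI0 pI0 fpI0 pfin.
move: (\int[nu]_(x in D) (fp x)%:E)%E (\int[nu]_(x in D) (fm x)%:E)%E
  (\int[nu]_(x in D) (p x)%:E)%E (\int[nu]_(x in D) (q x)%:E)%E => a F b Q.
case: a => [a||]; case: b => [b||]; case: F => [F||]; case: Q => [Q||] //=.
by rewrite -!EFinD => -[h] *; congr EFin; lra.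
Qed.

Variable s : R.

Definition kern_integral (r : R) (g : R -> R) : \bar R :=
  (\int[mu]_(x in `]r, +oo[) (g x * kern s r x)%:E)%E.

Lemma measurable_mul_kern (g : R -> R) (r a : R) : 0 <= r <= a ->
  measurable_fun (`]0, +oo[%classic : set R) g ->
  measurable_fun (`]a, +oo[%classic : set R) (fun x => g x * kern s r x).
Proof.
move=> /andP[r0 ra] mg; have sub b : b <= a -> `]a, +oo[%classic `<=` (`]b, +oo[%classic : set R).
  by move=> ba x; rewrite /= !in_itv/= !andbT; exact: le_lt_trans.
apply: measurable_funM.
  by apply: measurable_funS mg; [exact: measurable_itv|apply: sub; exact: le_trans ra].
by apply: (measurable_funS _ (sub r ra)); [exact: measurable_itv|exact: measurable_kern].
Qed.

Lemma kern_integral_ge0 (r : R) (g : R -> R) : 0 <= r ->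
  (forall x, 0 < x -> 0 <= g x) -> (0 <= kern_integral r g)%E.
Proof.
move=> r0 g0; apply: integral_ge0 => x /=; rewrite in_itv/= andbT => rx.
have x0 : 0 < x by exact: le_lt_trans rx.
by rewrite lee_fin mulr_ge0 ?g0// kern_ge0// ltW.
Qed.

Section Comparison.
Variables (g : R -> R) (K rho : R).
Hypotheses (mg : measurable_fun (`]0, +oo[%classic : set R) g)
  (g0 : forall x, 0 < x -> 0 <= g x)
  (gK : forall x, 0 < x < rho -> g x <= K * x ^+ 2) (K0 : 0 <= K).

(** Beyond r use k_0 <= k_r; on (0, r), which the right-hand integral omits, use the quadratic bound
    on [g]. *)
Lemma kern_integral0_le (r : R) : 0 < s < 1 -> 0 < r <= rho ->
  (kern_integral 0 g <= kern_integral r g + (K * kern_gap s r)%:E)%E.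
Proof.
move=> s01 /andP[r0 rrho].
have mgk : measurable_fun (`]0, +oo[%classic : set R) (fun x => g x * kern s 0 x).
  by apply: measurable_mul_kern => //; rewrite lexx.
rewrite /kern_integral (@ge0_integral_itvoy_split _ _ _ r)//; last 2 first.
- exact/measurable_EFinP.
- by move=> x x0; rewrite lee_fin mulr_ge0 ?g0// kern_ge0// ltW.
have far : (\int[mu]_(x in `]r, +oo[) (g x * kern s 0 x)%:E <= kern_integral r g)%E.
  apply: ge0_le_integral => //.
  - move=> x /=; rewrite in_itv/= andbT => rx; have x0 := lt_trans r0 rx.
    by rewrite lee_fin mulr_ge0 ?g0// kern_ge0// ltW.
  - by apply/measurable_EFinP; apply: measurable_mul_kern => //; rewrite lexx ltW.
  - by apply/measurable_EFinP; apply: measurable_mul_kern => //; rewrite lexx ltW.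
  - move=> x /=; rewrite in_itv/= andbT => rx; have x0 := lt_trans r0 rx.
    by rewrite lee_fin ler_wpM2l ?g0// kern_le// rx ltW.
suff near : (\int[mu]_(x in `]0%R, r[) (g x * kern s 0 x)%:E <= (K * kern_gap s r)%:E)%E.
  by apply: le_trans (leeD near far) _; rewrite addeC.
apply: (@le_trans _ _ (\int[mu]_(x in `]0%R, r[) (K%:E * (x ^+ 2 * kern s 0 x)%:E))%E).
  have sub : `]0, r[%classic `<=` (`]0, +oo[%classic : set R).
    by move=> x; rewrite /= !in_itv/= andbT => /andP[].
  apply: ge0_le_integral => //.
  - move=> x /=; rewrite in_itv/= => /andP[x0 _].
    by rewrite lee_fin mulr_ge0 ?g0// kern_ge0// ltW.
  - apply/measurable_EFinP; apply: (measurable_funS _ sub mgk); exact: measurable_itv.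
  - apply: measurable_funeM; apply/measurable_EFinP; apply: open_continuous_measurable_fun.
      exact: interval_open.
    by move=> x /set_mem /sub h; exact: continuous_sqr_kern.
  - move=> x /=; rewrite in_itv/= => /andP[x0 xr].
    rewrite -EFinM lee_fin mulrA ler_wpM2r ?kern_ge0 ?(ltW x0)// gK//.
    by rewrite x0 (lt_le_trans xr).
rewrite ge0_integralZl//.
- by rewrite EFinM lee_wpmul2l ?lee_fin// integral_sqr_kern_near.
- apply/measurable_EFinP; apply: open_continuous_measurable_fun.
    exact: interval_open.
  move=> x /set_mem /=; rewrite in_itv/= => /andP[x0 _].
  by apply: continuous_sqr_kern => //; rewrite in_itv/= x0.
- move=> x /=; rewrite in_itv/= => /andP[x0 _].
  by rewrite lee_fin mulr_ge0 ?sqr_ge0// kern_ge0// ltW.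
Qed.

(** On (r, rho) the surplus g (k_r - k_0) is at most K x^2 (k_r - k_0), whose integral is
    controlled. Beyond [rho] only g >= 0 is known, so no additive error is possible there and the
    relative bound of [kern_le_far] is used. *)
Lemma kern_integral_le0 (r : R) : 0 < s < 1 -> 0 < r -> r <= rho / 2 ->
  (kern_integral r g <= (1 + 2 * (r / rho) ^+ 2)%:E * kern_integral 0 g +
     (K * kern_gap s r)%:E)%E.
Proof.
move=> s01 r0 rrho; have rrho' : r < rho by lra.
set c := 1 + 2 * (r / rho) ^+ 2.
have c1 : 1 <= c by rewrite lerDl mulr_ge0 ?sqr_ge0.
have c0 : 0 <= c by lra.
have gk0 q x : 0 < x -> 0 <= g x * kern s q x.
  by move=> x0; rewrite mulr_ge0 ?g0// kern_ge0// ltW.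
have m0 : measurable_fun (`]0, +oo[%classic : set R) (fun x => g x * kern s 0 x).
  by apply: measurable_mul_kern => //; rewrite lexx.
have mr : measurable_fun (`]r, +oo[%classic : set R) (fun x => g x * kern s r x).
  by apply: measurable_mul_kern => //; rewrite lexx ltW.
have sub a b : 0 <= a -> [set` Interval (BRight a) b] `<=` (`]0, +oo[%classic : set R).
  move=> a0 x; rewrite /= !in_itv/= andbT => /andP[ax _].
  exact: le_lt_trans ax.
have subr : `]r, rho[%classic `<=` (`]r, +oo[%classic : set R).
  by move=> x; rewrite /= !in_itv/= andbT => /andP[].
rewrite {1}/kern_integral (@ge0_integral_itvoy_split _ _ _ rho)//; last 2 first.
- exact/measurable_EFinP.
- by move=> x rx; rewrite lee_fin gk0// (lt_trans r0).
pose J := (\int[mu]_(x in `]r, rho[) (g x * kern s 0 x)%:E)%E.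
pose J' := (\int[mu]_(x in `]rho, +oo[) (g x * kern s 0 x)%:E)%E.
have J0 : (0 <= J)%E.
  by apply: integral_ge0 => x /(sub _ _ (ltW r0)) /=; rewrite in_itv/= andbT lee_fin; exact: gk0.
have J'0 : (0 <= J')%E.
  apply: integral_ge0 => x; rewrite /= in_itv/= andbT lee_fin => rx.
  by apply: gk0; lra.
have far : (\int[mu]_(x in `]rho, +oo[) (g x * kern s r x)%:E <= c%:E * J')%E.
  rewrite /J' -ge0_integralZl//.
  - apply: ge0_le_integral => //.
    + move=> x /=; rewrite in_itv/= andbT => rx.
      by rewrite lee_fin gk0//; lra.
    + apply/measurable_EFinP; apply: measurable_mul_kern => //.
      by rewrite (ltW r0) ltW.
    + apply: measurable_funeM; apply/measurable_EFinP.
      by apply: measurable_mul_kern => //; rewrite lexx/=; lra.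
    + move=> x /=; rewrite in_itv/= andbT => rx.
      rewrite -EFinM lee_fin mulrCA ler_wpM2l ?g0//; first lra.
      by apply: kern_le_far => //; exact: ltW.
  - by apply/measurable_EFinP; apply: measurable_mul_kern => //; rewrite lexx/=; lra.
  - by move=> x /=; rewrite in_itv/= andbT => rx; rewrite lee_fin gk0//; lra.
have near : (\int[mu]_(x in `]r, rho[) (g x * kern s r x)%:E <= J + (K * kern_gap s r)%:E)%E.
  have md : measurable_fun (`]r, rho[%classic : set R)
      (fun x : R => (x ^+ 2 * (kern s r x - kern s 0 x))%:E).
    apply/measurable_EFinP; apply: open_continuous_measurable_fun; first exact: interval_open.
    move=> x /set_mem/=; rewrite in_itv/= => /andP[rx _].
    apply: cvgM; first exact: exprn_continuous.
    apply: cvgB; apply: continuous_kern => //; rewrite ?in_itv/= ?andbT ?ltW//.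
    exact: lt_trans rx.
  have d0 x : (`]r, rho[%classic : set R) x -> 0 <= x ^+ 2 * (kern s r x - kern s 0 x).
    rewrite /= in_itv/= => /andP[rx _].
    by rewrite mulr_ge0 ?sqr_ge0// subr_ge0 kern_le// (ltW r0).
  apply: (@le_trans _ _ (J + K%:E *
      \int[mu]_(x in `]r, rho[) (x ^+ 2 * (kern s r x - kern s 0 x))%:E)%E); last first.
    by rewrite leeD2l// EFinM lee_wpmul2l ?lee_fin// integral_sqr_kern_diff.
  have mJ : measurable_fun (`]r, rho[%classic : set R) (fun x => (g x * kern s 0 x)%:E).
    apply/measurable_EFinP; apply: (measurable_funS _ (sub _ _ (ltW r0)) m0).
    exact: measurable_itv.
  rewrite -ge0_integralZl// -ge0_integralD//; last 3 first.
  - by move=> x /(sub _ _ (ltW r0)) /=; rewrite in_itv/= andbT lee_fin; exact: gk0.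
  - by move=> x /d0 h; rewrite -EFinM lee_fin mulr_ge0.
  - exact: measurable_funeM.
  apply: ge0_le_integral => //.
  - by move=> x /(sub _ _ (ltW r0)) /=; rewrite in_itv/= andbT lee_fin; exact: gk0.
  - apply/measurable_EFinP; apply: (measurable_funS _ subr mr); exact: measurable_itv.
  - by apply: emeasurable_funD => //; exact: measurable_funeM.
  - move=> x /=; rewrite in_itv/= => /andP[rx xrho]; have x0 := lt_trans r0 rx.
    have kd : 0 <= kern s r x - kern s 0 x by rewrite subr_ge0 kern_le// (ltW r0).
    rewrite -EFinM -EFinD lee_fin mulrA -lerBlDl -mulrBr ler_wpM2r//.
    by rewrite gK// x0.
have JJ : (J + J' <= kern_integral 0 g)%E.
  rewrite /J /J' -ge0_integral_itvoy_split//; last 2 first.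
  - apply/measurable_EFinP; apply: measurable_mul_kern => //.
    by rewrite lexx ltW.
  - by move=> x rx; rewrite lee_fin gk0// (lt_trans r0).
  apply: ge0_subset_integral => //; first exact/measurable_EFinP.
  - by move=> x /=; rewrite in_itv/= andbT lee_fin; exact: gk0.
  - by move=> x /=; rewrite !in_itv/= !andbT; exact: lt_trans.
apply: (@le_trans _ _ ((J + (K * kern_gap s r)%:E) + c%:E * J')%E); first exact: leeD.
apply: (@le_trans _ _ (c%:E * (J + J') + (K * kern_gap s r)%:E)%E).
  rewrite (ge0_muleDr c%:E J0 J'0) [leLHS]addeAC leeD2r// leeD2r//.
  by rewrite -[leLHS]mul1e lee_wpmul2r// lee_fin.
by rewrite leeD2r// lee_wpmul2l// lee_fin.
Qed.

End Comparison.

End OneDimensional.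

(** * The one-variable equivalence *)

Section Core.
Context {R : realType}.
Notation mu := (@lebesgue_measure R).

Lemma powR_small_le0 (s b x C : R) : s < 1 -> 0 < b ->
  (forall r, 0 < r < b -> x <= C * (r ^+ 2) `^ (1 - s)) -> x <= 0.
Proof.
move=> s1 b0 H; rewrite leNgt; apply/negP => x0.
pose e := (2 * (1 - s))^-1; have e0 : 0 < e by rewrite invr_gt0; lra.
(* [z] is the value that r^(2-2s) is to take: small enough that r = z^e < b and that C z < x,
   contradicting the hypothesis at r. *)
pose z := Num.min (b `^ (2 * (1 - s))) (x / (`|C| + 1)) / 2.
have C1 : 0 < `|C| + 1 by rewrite ltr_wpDl.
have z0 : 0 < z by rewrite divr_gt0// lt_min powR_gt0// divr_gt0.
have zb : z < b `^ (2 * (1 - s)).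
  have : Num.min (b `^ (2 * (1 - s))) (x / (`|C| + 1)) <= b `^ (2 * (1 - s)).
    by rewrite ge_min lexx.
  by move: z0; rewrite /z; lra.
have zx : z < x / (`|C| + 1).
  have : Num.min (b `^ (2 * (1 - s))) (x / (`|C| + 1)) <= x / (`|C| + 1).
    by rewrite ge_min lexx orbT.
  by move: z0; rewrite /z; lra.
have zr : ((z `^ e) ^+ 2) `^ (1 - s) = z.
  have -> : ((z `^ e) ^+ 2) `^ (1 - s) = z `^ (e * 2 * (1 - s)).
    by rewrite !powRrM powR_mulrn ?powR_ge0.
  by rewrite -mulrA mulVf ?powRr1 ?(ltW z0)// gt_eqF//; lra.
have rb : 0 < z `^ e < b.
  rewrite powR_gt0//=.
  have E : b = (b `^ (2 * (1 - s))) `^ e.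
    by rewrite -powRrM mulfV ?powRr1 ?(ltW b0)// gt_eqF//; lra.
  by rewrite [ltRHS]E gt0_ltr_powR// nnegrE ?powR_ge0// ltW.
have := H _ rb; rewrite zr.
have : C * z <= `|C| * z by rewrite ler_wpM2r ?(ltW z0)// ler_norm.
move: zx; rewrite ltr_pdivlMr// => zx; lra.
Qed.

Variable s : R.

Lemma kern_integral_pos_neg (r : R) (G : R -> R) : 0 <= r ->
  (kern_integral s r G =
   kern_integral s r (fun x => Num.max (G x) 0)%R
   - kern_integral s r (fun x => Num.max (- G x) 0)%R)%E.
Proof.
move=> r0; rewrite /kern_integral integralE; congr (_ - _)%E; apply: eq_integral => x;
  rewrite inE/= in_itv/= andbT => /(le_lt_trans r0) x0.
  by rewrite funeposE -EFin_max maxr_pMl ?mul0r// kern_ge0// ltW.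
by rewrite funenegE -EFinN -mulNr -EFin_max maxr_pMl ?mul0r// kern_ge0// ltW.
Qed.

Lemma kern_integral_cstD (r b : R) (g : R -> R) : 0 < s < 1 -> 0 < r -> 0 <= b ->
  measurable_fun (`]0, +oo[%classic : set R) g -> (forall x, 0 < x -> 0 <= g x) ->
  (kern_integral s r (fun x => b + g x)%R =
   (b * (pi / sin (pi * s) / (2 * r `^ (2 * s))))%:E + kern_integral s r g)%E.
Proof.
move=> s01 r0 b0 mg g0.
have k0 x : (`]r, +oo[%classic : set R) x -> 0 <= kern s r x.
  by rewrite /= in_itv/= andbT => rx; rewrite kern_ge0// ltW// (lt_trans r0).
have b0' : (0 <= b%:E)%E by rewrite lee_fin.
rewrite EFinM -(integral_kern s01 r0) -ge0_integralZl//; last first.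
  by apply/measurable_EFinP; apply: measurable_kern; exact: ltW.
rewrite /kern_integral -ge0_integralD//.
- by apply: eq_integral => x _; rewrite -EFinM -EFinD mulrDl.
- by move=> x /k0 h; rewrite -EFinM lee_fin mulr_ge0.
- by apply: measurable_funeM; apply/measurable_EFinP; apply: measurable_kern; exact: ltW.
- move=> x rx; rewrite lee_fin mulr_ge0 ?k0// g0//.
  by move: rx; rewrite /= in_itv/= andbT; exact: lt_trans.
- by apply/measurable_EFinP; apply: measurable_mul_kern; rewrite ?lexx ?ltW.
Qed.

(** Finiteness of the negative part rules out +oo - +oo, which is -oo by convention and hence not
    odd under a change of sign. *)
Lemma kern_integralN (r : R) (G : R -> R) : 0 <= r ->
  (kern_integral s r (fun x => Num.max (- G x) 0)%R < +oo)%E ->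
  (kern_integral s r (fun x => - G x)%R = - kern_integral s r G)%E.
Proof.
move=> r0 fin.
rewrite (kern_integral_pos_neg (fun x => - G x)) // (kern_integral_pos_neg G)//.
have -> : (fun x => Num.max (- - G x) 0) = (fun x => Num.max (G x) 0).
  by apply/funext => x; rewrite opprK.
have : (0 <= kern_integral s r (fun x => Num.max (- G x) 0)%R)%E.
  by apply: kern_integral_ge0 => // x _; rewrite le_max lexx orbT.
move: fin; case: (kern_integral s r (fun x => Num.max (- G x) 0)%R) => [N||]// _ _.
by case: (kern_integral s r _) => [P||]//; rewrite -!(EFinN, EFinD) opprB.
Qed.

Lemma kern_integral_lty (r M : R) (g : R -> R) : 0 < s < 1 -> 0 < r -> 0 <= M ->
  measurable_fun (`]0, +oo[%classic : set R) g ->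
  (forall x, 0 < x -> 0 <= g x <= M) -> (kern_integral s r g < +oo)%E.
Proof.
move=> s01 r0 M0 mg gM.
have z0 (x : R) : 0 < x -> 0 <= cst (0 : R) x by [].
have := kern_integral_cstD s01 r0 M0 (measurable_cst (0 : R)) z0.
rewrite {2}/kern_integral; under [X in (_ + X)%E]eq_integral do rewrite mul0r.
rewrite integral0 adde0 => E; apply: (@le_lt_trans _ _
  (kern_integral s r (fun=> M + 0)%R)%E); last by rewrite E ltry.
apply: ge0_le_integral => //.
- move=> x; rewrite /= in_itv/= andbT => rx; have x0 := lt_trans r0 rx.
  by rewrite lee_fin mulr_ge0 ?kern_ge0 ?(ltW x0)//; have /andP[] := gM x x0.
- by apply/measurable_EFinP; apply: measurable_mul_kern => //; rewrite lexx ltW.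
- by apply/measurable_EFinP; apply: measurable_mul_kern => //; rewrite lexx ltW.
- move=> x; rewrite /= in_itv/= andbT => rx; have x0 := lt_trans r0 rx.
  rewrite lee_fin ler_wpM2r ?kern_ge0 ?(ltW x0)// addr0.
  by have /andP[] := gM x x0.
Qed.

Lemma kern_integral0_lty (K rho M : R) (g : R -> R) :
  0 < s < 1 -> 0 < rho -> 0 <= K -> 0 <= M ->
  measurable_fun (`]0, +oo[%classic : set R) g ->
  (forall x, 0 < x < rho -> g x <= K * x ^+ 2) ->
  (forall x, 0 < x -> 0 <= g x <= M) -> (kern_integral s 0 g < +oo)%E.
Proof.
move=> s01 rho0 K0 M0 mg gK gM.
have g0 x : 0 < x -> 0 <= g x by move=> /gM/andP[].
have rr : 0 < rho <= rho by rewrite rho0 lexx.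
apply: (le_lt_trans (kern_integral0_le mg g0 gK K0 s01 rr)).
by rewrite lte_add_pinfty ?ltry// (kern_integral_lty s01 rho0 M0).
Qed.

(** The normalisation of the mean: [c] times the integral of 2 A k_r is 1, so the constant part
    contributes exactly [v]. The part [p] may have infinite integral, in which case both sides are
    -oo. *)
Lemma kern_integral_mean (A v r : R) (p q : R -> R) :
  0 < s < 1 -> 0 < A -> 0 < r ->
  measurable_fun (`]0, +oo[%classic : set R) p ->
  measurable_fun (`]0, +oo[%classic : set R) q ->
  (forall x, 0 < x -> 0 <= p x) -> (forall x, 0 < x -> 0 <= q x) ->
  (kern_integral s r q < +oo)%E ->
  let c := sin (pi * s) / pi * A^-1 * r `^ (2 * s) in
  (c%:E * kern_integral s r (fun x => 2 * A * v - (p x - q x))%R =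
   v%:E + c%:E * (kern_integral s r q - kern_integral s r p))%E.
Proof.
move=> s01 A0 r0 mp mq p0 q0 qfin c.
pose I := pi / sin (pi * s) / (2 * r `^ (2 * s)).
have sin0 : 0 < sin (pi * s).
  have := @pi_gt0 R; have /andP[s0 s1] := s01 => ppi.
  by apply: sin_gt0_pi; rewrite mulr_gt0//= gtr_pMr.
have rs0 : 0 < r `^ (2 * s) by rewrite powR_gt0.
have c0 : 0 < c by rewrite !mulr_gt0 ?invr_gt0// pi_gt0.
have cI : c * (2 * A * I) = 1.
  rewrite /c /I; have := @pi_gt0 R; move: sin0 rs0.
  move: pi (_ `^ _) (sin _) => y w S S0 w0 y0.
  by field; rewrite !gt_eqF.
(* 2 A v has unknown sign; as bp - bq with both terms nonnegative, it can be shared between two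
   integrals of nonnegative functions. *)
pose bp := 2 * A * `|v|; pose bq := 2 * A * (`|v| - v).
have bp0 : 0 <= bp by rewrite !mulr_ge0// ltW.
have bq0 : 0 <= bq by rewrite mulr_ge0 ?subr_ge0 ?ler_norm// mulr_ge0// ltW.
have E : kern_integral s r (fun x => 2 * A * v - (p x - q x)) =
    (kern_integral s r (fun x => bp + q x)%R - kern_integral s r (fun x => bq + p x)%R)%E.
  rewrite {2 3}/kern_integral -integral_sub_ge0//.
  - by apply: eq_integral => x _; congr EFin; rewrite /bp /bq; ring.
  - by apply: measurable_mul_kern; rewrite ?lexx ?ltW//; exact: measurable_funD.
  - by apply: measurable_mul_kern; rewrite ?lexx ?ltW//; exact: measurable_funD.
  - move=> x; rewrite /= in_itv/= andbT => rx; have x0 := lt_trans r0 rx.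
    by rewrite mulr_ge0 ?kern_ge0 ?(ltW x0)// addr_ge0// q0.
  - move=> x; rewrite /= in_itv/= andbT => rx; have x0 := lt_trans r0 rx.
    by rewrite mulr_ge0 ?kern_ge0 ?(ltW x0)// addr_ge0// p0.
  - have := kern_integral_cstD s01 r0 bp0 mq q0; rewrite /kern_integral => ->.
    by rewrite lte_add_pinfty// ltry.
rewrite E (kern_integral_cstD s01 r0 bp0 mq q0) (kern_integral_cstD s01 r0 bq0 mp p0).
have := kern_integral_ge0 s (ltW r0) p0.
have := kern_integral_ge0 s (ltW r0) q0; move: qfin; rewrite -/I.
move: (kern_integral s r p) (kern_integral s r q) => P Q.
case: Q => [Q||]//; case: P => [P||]// _ _ _.
  rewrite -!(EFinD, EFinN, EFinM); congr EFin.
  have -> : c * (bp * I + Q - (bq * I + P)) = c * (2 * A * I) * v + c * (Q - P).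
    by rewrite /bp /bq; ring.
  by rewrite cI mul1r.
by rewrite /= gt0_muleNy ?lte_fin.
Qed.

(** The prefactor r^(2s) of the mean turns the kernel error of order r^(2-2s) into order r^2. *)
Lemma powR_kern_gap (r : R) : 0 < r ->
  r `^ (2 * s) * kern_gap s r = r ^+ 2 / (2 * (1 - s)).
Proof.
move=> r0; rewrite /kern_gap mulrA -powR_mulrn ?(ltW r0)// -powRrM -powRD; last first.
  by rewrite (gt_eqF r0) implybT.
by congr (_ `^ _ / _); ring.
Qed.

(** Let P r and Q r be the integrals of the positive and negative parts of [G] against k_r. The
    lower bound on [G] makes Q r finite, the mean equals v + c r (Q r - P r), and P r, Q r are each
    compared with P 0, Q 0, so P may be infinite throughout. *)
Lemma mean_value_core (A v K rho M : R) (G : R -> R) :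
  0 < s < 1 -> 0 < A -> 0 < rho -> 0 <= K ->
  measurable_fun (`]0, +oo[%classic : set R) G ->
  (forall x, 0 < x < rho -> `|G x| <= K * x ^+ 2) ->
  (forall x, 0 < x -> - M <= G x) ->
  (0 <= kern_integral s 0 G)%E <->
  exists f : R -> R,
    (exists2 C, 0 < C & \forall r \near 0^'+, `|f r| <= C * r ^+ 2) /\
    forall r, 0 < r ->
      ((sin (pi * s) / pi * A^-1 * r `^ (2 * s))%:E *
        kern_integral s r (fun x => (2 * A * v - G x)%R) + (f r)%:E <= v%:E)%E.
Proof.
move=> s01 A0 rho0 K0 mG GK GM; have /andP[s0 s1] := s01.
pose p x := Num.max (G x) 0; pose q x := Num.max (- G x) 0.
have GE x : G x = p x - q x by rewrite /p /q !maxEle; case: ifPn; case: ifPn; lra.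
have mp : measurable_fun (`]0, +oo[%classic : set R) p by apply: measurable_maxr.
have mq : measurable_fun (`]0, +oo[%classic : set R) q.
  by apply: measurable_maxr => //; exact: measurableT_comp.
have p0 (x : R) : 0 < x -> 0 <= p x by rewrite le_max lexx orbT.
have q0 (x : R) : 0 < x -> 0 <= q x by rewrite le_max lexx orbT.
have pK x : 0 < x < rho -> p x <= K * x ^+ 2.
  move=> /GK; rewrite ler_norml => /andP[_ h].
  by rewrite ge_max h mulr_ge0// sqr_ge0.
have qK x : 0 < x < rho -> q x <= K * x ^+ 2.
  move=> /GK; rewrite ler_norml => /andP[h _].
  by rewrite ge_max lerNl h mulr_ge0// sqr_ge0.
pose P r := kern_integral s r p; pose Q r := kern_integral s r q.
have P0 r : 0 <= r -> (0 <= P r)%E by move=> r0; exact: kern_integral_ge0.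
have Q0 r : 0 <= r -> (0 <= Q r)%E by move=> r0; exact: kern_integral_ge0.
have M0 : 0 <= Num.max M 0 by rewrite le_max lexx orbT.
have qM x : 0 < x -> 0 <= q x <= Num.max M 0.
  by move=> x0; rewrite q0//= ge_max !le_max lexx orbT andbT lerNl GM.
have Qfin r : 0 < r -> (Q r < +oo)%E by move=> r0; exact: kern_integral_lty qM.
have PleP r := kern_integral0_le mp p0 pK K0 (r := r) s01.
have QleQ r := kern_integral0_le mq q0 qK K0 (r := r) s01.
have PgeP r := kern_integral_le0 mp p0 pK K0 (r := r) s01.
have QgeQ r := kern_integral_le0 mq q0 qK K0 (r := r) s01.
have Q0fin : (Q 0%R < +oo)%E by exact: kern_integral0_lty qK qM.
pose c r := sin (pi * s) / pi * A^-1 * r `^ (2 * s).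
have c0 r : 0 < r -> 0 < c r.
  move=> r0; have ppi := @pi_gt0 R.
  rewrite !mulr_gt0 ?invr_gt0 ?powR_gt0//.
  by apply: sin_gt0_pi; rewrite mulr_gt0//= gtr_pMr.
have meanE r : 0 < r ->
    ((c r)%:E * kern_integral s r (fun x => (2 * A * v - G x)%R) =
     v%:E + (c r)%:E * (Q r - P r))%E.
  move=> r0; rewrite -(kern_integral_mean v s01 A0 r0 mp mq p0 q0 (Qfin r r0)).
  by congr (_ * _)%E; apply: eq_integral => x _; rewrite -GE.
rewrite kern_integral_pos_neg// -/p -/q -/(P 0) -/(Q 0).
have [n0 Q0E] : exists n0, Q 0 = n0%:E.
  by exists (fine (Q 0)); rewrite fineK// ge0_fin_numE// Q0.
have n00 : 0 <= n0 by rewrite -lee_fin -Q0E Q0.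
have QE r : 0 < r -> Q r = (fine (Q r))%:E.
  by move=> r0; rewrite fineK// ge0_fin_numE ?Qfin// Q0// ltW.
rewrite Q0E; split.
- rewrite sube_ge0// => n0P.
  pose r1 := Num.min (rho / 2) 1.
  have r10 : 0 < r1 by rewrite lt_min ltr01 andbT divr_gt0.
  (* For small r, Q r exceeds n0 by at most 2 (r/rho)^2 n0 plus one gap, and n0 <= P 0 <= P r plus
     another. For large r only Q r <= P r + e r is asked, and the finite number Q r does it. *)
  pose e r := if r < r1 then 2 * (r / rho) ^+ 2 * n0 + 2 * K * kern_gap s r
              else fine (Q r).
  exists (fun r => - (c r * e r)); split.
    (* [C] is the coefficient of r^2 in c r * e r after bounding r^(2s) by 1, which is why r1 <=
       1. *)
    pose C := sin (pi * s) / pi * A^-1 * (2 / rho ^+ 2 * n0 + K / (1 - s)).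
    exists (`|C| + 1); first by rewrite ltr_wpDl.
    near=> r.
    have r0 : 0 < r by near: r; exact: nbhs_right_gt.
    have rr1 : r < r1 by near: r; exact: nbhs_right_lt.
    have r_1 : r <= 1 by move: rr1; rewrite lt_min => /andP[_ /ltW].
    rewrite normrN /e rr1.
    have rs0 : 0 < r `^ (2 * s) by rewrite powR_gt0.
    have rs1 : r `^ (2 * s) <= 1.
      suff : r `^ (2 * s) <= 1 `^ (2 * s) by rewrite powR1.
      by rewrite ge0_ler_powR ?nnegrE ?(ltW r0)//; lra.
    have E : c r * (2 * (r / rho) ^+ 2 * n0 + 2 * K * kern_gap s r) =
        sin (pi * s) / pi * A^-1 *
        (2 / rho ^+ 2 * n0 * r `^ (2 * s) + K / (1 - s)) * r ^+ 2.
      have -> : c r * (2 * (r / rho) ^+ 2 * n0 + 2 * K * kern_gap s r) =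
        sin (pi * s) / pi * A^-1 * (r `^ (2 * s) * (2 * (r / rho) ^+ 2 * n0)
          + 2 * K * (r `^ (2 * s) * kern_gap s r)) by rewrite /c; ring.
      rewrite powR_kern_gap//; move: (sin _ / pi * A^-1) (_ `^ _) => a b.
      by field; rewrite !gt_eqF//; lra.
    have a0 : 0 <= sin (pi * s) / pi * A^-1.
      by have := c0 r r0; rewrite /c pmulr_lgt0// => /ltW.
    have d0 : 0 <= 2 / rho ^+ 2 * n0 by rewrite mulr_ge0// divr_ge0// sqr_ge0.
    have d1 : 0 <= K / (1 - s) by rewrite divr_ge0//; lra.
    have lC : sin (pi * s) / pi * A^-1 *
        (2 / rho ^+ 2 * n0 * r `^ (2 * s) + K / (1 - s)) <= C.
      by rewrite ler_wpM2l// lerD2r ler_piMr.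
    rewrite E ger0_norm; last first.
      by rewrite mulr_ge0 ?sqr_ge0// mulr_ge0// addr_ge0// mulr_ge0// ltW.
    rewrite ler_wpM2r ?sqr_ge0//; apply: (le_trans lC).
    by have := ler_norm C; lra.
  move=> r r0; rewrite -/(c r) meanE// (QE r r0).
  have key : ((fine (Q r))%:E <= P r + (e r)%:E)%E.
    rewrite /e; case: ifPn => [rr1|_]; last by apply: leeDr; exact: P0 (ltW r0).
    have rrho : r <= rho / 2 by move: rr1; rewrite lt_min => /andP[/ltW].
    have rrho' : 0 < r <= rho by rewrite r0/=; lra.
    have := QgeQ r r0 rrho; rewrite -/(Q r) -/(Q 0) Q0E (QE r r0) => /le_trans; apply.
    have : (n0%:E <= P r + (K * kern_gap s r)%:E)%E := le_trans n0P (PleP r rrho').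
    case: (P r) (P0 r (ltW r0)) => [x||]// _; last by move=> _; rewrite addye ?leey.
    rewrite -!(EFinM, EFinD) !lee_fin => h; lra.
  case: (P r) key (P0 r (ltW r0)) => [x||]// key _; last first.
    by rewrite /= gt0_muleNy ?lte_fin ?c0// leNye.
  move: key; rewrite -!(EFinD, EFinN, EFinM) !lee_fin => key.
  have h : c r * (fine (Q r) - x) <= c r * e r by rewrite ler_pM2l ?c0//; lra.
  lra.
- case=> f [[C1 C10 [d /= d0 fC1]] fP].
  (* If P 0 is infinite the sign is clear. Otherwise n0 - x is bounded by a multiple of r^(2-2s) for
     all small r, using Q 0 against Q r, then the expansion, then P r against P 0. *)
  case P0E : (P 0) (P0 0 (lexx _)) => [x||]// x0.
  rewrite lee_fin in x0; rewrite -EFinB lee_fin -oppr_le0 opprB.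
  pose a := sin (pi * s) / pi * A^-1.
  have a0 : 0 < a by have := c0 1 ltr01; rewrite /c powR1 mulr1.
  pose b := Num.min (Num.min d (rho / 2)) 1.
  have b0 : 0 < b by rewrite !lt_min d0 ltr01 divr_gt0.
  apply: (@powR_small_le0 s b _ (C1 / a + 2 * x / rho ^+ 2 + K / (1 - s))) => // r.
  move=> /andP[r0]; rewrite !lt_min => /andP[/andP[rd rrho] r_1].
  have rrho' : 0 < r <= rho by rewrite r0/=; lra.
  have {}fC1 : `|f r| <= C1 * r ^+ 2 by apply: fC1 => //=; rewrite sub0r normrN gtr0_norm.
  have := PgeP r r0 (ltW rrho); have := QleQ r rrho'; have := fP r r0.
  rewrite -/(c r) meanE// -/(P r) -/(Q r) -/(P 0) -/(Q 0) P0E Q0E (QE r r0).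
  move: (fine (Q r)) => m; case: (P r) (P0 r (ltW r0)) => [y||]// _.
  rewrite -!(EFinD, EFinN, EFinM) !lee_fin => h1 h2 h3.
  set w := (r ^+ 2) `^ (1 - s).
  have rs0 : 0 < r `^ (2 * s) by rewrite powR_gt0.
  have rs1 : r `^ (2 * s) <= 1.
    suff : r `^ (2 * s) <= 1 `^ (2 * s) by rewrite powR1.
    by rewrite ge0_ler_powR ?nnegrE ?(ltW r0)//; lra.
  have w0 : 0 <= w by exact: powR_ge0.
  have rw : r ^+ 2 = r `^ (2 * s) * w.
    rewrite /w -powR_mulrn ?(ltW r0)// -powRrM -powRD ?(gt_eqF r0) ?implybT//.
    by congr (_ `^ _); ring.
  have rw' : r ^+ 2 <= w by rewrite rw ler_piMl.
  have tE : 2 * (K * kern_gap s r) = K / (1 - s) * w.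
    by rewrite /kern_gap -/w; field; rewrite gt_eqF//; lra.
  have h4 : m - y <= C1 / a * w.
    have : a * r `^ (2 * s) * (m - y) <= C1 * (r `^ (2 * s) * w).
      by rewrite -rw; move: fC1 h1; rewrite ler_norml /c -/a => /andP[]; lra.
    rewrite -mulrA mulrCA [X in _ <= X]mulrCA ler_pM2l// => h.
    by rewrite mulrAC ler_pdivlMr// mulrC.
  have h5 : 2 * (r / rho) ^+ 2 * x <= 2 * x / rho ^+ 2 * w.
    have -> : 2 * (r / rho) ^+ 2 * x = 2 * x / rho ^+ 2 * r ^+ 2.
      by field; rewrite gt_eqF.
    by rewrite ler_wpM2l// divr_ge0 ?sqr_ge0// mulr_ge0.
  lra.
Unshelve. all: by end_near. Qed.

(** The previous lemma for -G and -v. The upper bound on [G], with the quadratic bound near 0, makes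
    its positive part integrable, so the integrals change sign without meeting +oo - +oo. *)
Lemma mean_value_core_sub (A v K rho M : R) (G : R -> R) :
  0 < s < 1 -> 0 < A -> 0 < rho -> 0 <= K ->
  measurable_fun (`]0, +oo[%classic : set R) G ->
  (forall x, 0 < x < rho -> `|G x| <= K * x ^+ 2) ->
  (forall x, 0 < x -> G x <= M) ->
  ((kern_integral s 0 G <= 0)%E) <->
  exists f : R -> R,
    (exists2 C, 0 < C & \forall r \near 0^'+, `|f r| <= C * r ^+ 2) /\
    forall r, 0 < r ->
      (v%:E <= (sin (pi * s) / pi * A^-1 * r `^ (2 * s))%:E *
        kern_integral s r (fun x => (2 * A * v - G x)%R) + (f r)%:E)%E.
Proof.
move=> s01 A0 rho0 K0 mG GK GM.
have max0 (y : R) : 0 <= Num.max y 0 by rewrite le_max lexx orbT.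
have mN : measurable_fun (`]0, +oo[%classic : set R) (fun x => - G x).
  exact: measurableT_comp.
have NK x : 0 < x < rho -> `|- G x| <= K * x ^+ 2 by rewrite normrN; exact: GK.
have NM x : 0 < x -> - M <= - G x by rewrite lerN2; exact: GM.
have core := mean_value_core (- v) s01 A0 rho0 K0 mN NK NM.
have E0 : kern_integral s 0 G = (- kern_integral s 0 (fun x => - G x)%R)%E.
  rewrite -kern_integralN//.
    by congr kern_integral; apply/funext => x; rewrite opprK.
  have -> : (fun x => Num.max (- - G x) 0) = (fun x => Num.max (G x) 0).
    by apply/funext => x; rewrite opprK.
  apply: (kern_integral0_lty (M := Num.max M 0) s01 rho0 K0) => //.
  - by apply: measurable_maxr.
  - move=> x /GK; rewrite ler_norml => /andP[_ h].
    by rewrite ge_max h mulr_ge0// sqr_ge0.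
  - by move=> x x0; rewrite max0 ge_max !le_max lexx orbT andbT GM.
have Er r : 0 < r -> kern_integral s r (fun x => 2 * A * - v - - G x) =
    (- kern_integral s r (fun x => 2 * A * v - G x)%R)%E.
  move=> r0; rewrite -kern_integralN ?(ltW r0)//.
    by congr kern_integral; apply/funext => x; ring.
  apply: (kern_integral_lty (M := Num.max (M - 2 * A * v) 0) s01 r0) => //.
    apply: measurable_maxr => //; apply: measurableT_comp => //.
    exact: measurable_funB.
  move=> x x0; rewrite max0 ge_max !le_max lexx orbT andbT opprB lerD2r.
  by rewrite GM.
have flip (X : \bar R) (y c : R) : ((c%:E * - X + y%:E <= (- v)%:E) =
    (v%:E <= c%:E * X + (- y)%:E))%E.
  have -> : (c%:E * - X + y%:E = - (c%:E * X + (- y)%:E))%E.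
    by rewrite fin_num_oppeD// -EFinN opprK muleN.
  by rewrite (EFinN v) leeN2.
rewrite E0 oppe_le0; apply: (iff_trans core); split=> -[f [[C C0 fC] fP]].
  exists (fun r => - f r); split; first by exists C => //; under eq_near do rewrite normrN.
  by move=> r r0; have := fP r r0; rewrite Er// flip.
exists (fun r => - f r); split; first by exists C => //; under eq_near do rewrite normrN.
by move=> r r0; have := fP r r0; rewrite Er// flip opprK.
Qed.

End Core.

(** * Spherical integrals of second differences *)

Section BorelRowVectors.
Context {R : realType} {n : nat}.
Local Notation V := 'rV[R]_n.

Lemma coord_le_norm (x : V) i : `|x ord0 i| <= `|x|.
Proof.
by rewrite [leRHS]/Num.norm/= mx_normrE; apply/bigmax_geP; right; exists (ord0, i).
Qed.

Lemma rV_norm_lt (x : V) (e : R) : 0 < e -> (forall i, `|x ord0 i| < e) -> `|x| < e.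
Proof.
move=> e0 xe; rewrite /Num.norm/= mx_normrE; apply/bigmax_ltP; split => // -[i j] _ /=.
by rewrite (ord1 i).
Qed.

Lemma rV_norm_le (x : V) (e : R) : 0 <= e -> (forall i, `|x ord0 i| <= e) -> `|x| <= e.
Proof.
move=> e0 xe; rewrite /Num.norm/= mx_normrE; apply/bigmax_leP; split => // -[i j] _ /=.
by rewrite (ord1 i).
Qed.

Lemma open_measurable_rV (D : set V) : open D -> measurable D.
Proof. exact: sub_sigma_algebra. Qed.

Lemma open_continuous_measurable_rV (D : set V) (f : V -> R) : open D ->
  {in D, continuous f} -> measurable_fun D f.
Proof.
move=> oD; rewrite -(continuous_open_subspace f oD) => /continuousP cf.
apply: (measurability _ (RGenOpens.measurableE R)).
move=> _ [_ [a [b ->] <-]]; apply: open_measurable_rV.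
have /cf := interval_open (a := BRight a) (b := BLeft b) erefl erefl.
by rewrite open_setSI.
Qed.

Lemma measurable_coord i : measurable_fun [set: V] (fun x : V => x ord0 i).
Proof.
apply: open_continuous_measurable_rV; first exact: openT.
by move=> x _; exact: coord_continuous.
Qed.

Let rat_ball (q : 'rV[rat]_n * nat) : set V :=
  [set y | forall i, `|y ord0 i - ratr (q.1 ord0 i)| < q.2.+1%:R^-1].

Lemma open_rV_bigcup (D : set V) : open D ->
  D = \bigcup_(q in [set q | rat_ball q `<=` D]) rat_ball q.
Proof.
move=> oD; apply/seteqP; split => [x Dx|x [q /= qD qx]]; last exact: qD.
have /nbhs_ballP[e /= e0 xeD] := open_nbhs_nbhs (conj oD Dx).
pose k := Num.truncn (2 / e).
have k0 : 0 < k.+1%:R^-1 :> R by rewrite invr_gt0.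
have ke : k.+1%:R^-1 <= e / 2.
  rewrite -[e / 2]invf_div lef_pV2 ?posrE ?divr_gt0//.
  by rewrite ltW// truncnS_gt.
have /choice[q qP] (i : 'I_n) : exists q : rat, `|x ord0 i - ratr q| < k.+1%:R^-1.
  have [q] := @rat_in_itvoo R (x ord0 i - k.+1%:R^-1) (x ord0 i) ltac:(by rewrite gtrBl).
  rewrite in_itv/= => /andP[h1 h2]; exists q.
  by move: k0 h1 h2; move: (_^-1) => z k0 h1 h2; rewrite ltr_norml; apply/andP; split; lra.
exists (\row_i q i, k); last by move=> i; rewrite mxE.
move=> y yq; apply: xeD; rewrite -ball_normE/=; apply: rV_norm_lt => // i.
have := yq i; have := qP i; rewrite !mxE/= => h1 h2.
rewrite (_ : _ - _ = (x ord0 i - ratr (q i)) - (y ord0 i - ratr (q i))); last by ring.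
apply: (le_lt_trans (ler_normB _ _)); rewrite (splitr e).
by apply: ltrD; [exact: lt_le_trans h1 ke|exact: lt_le_trans h2 ke].
Qed.

(** Open sets are countable unions of rational cubes, and the preimage of a cube is a finite
    intersection of coordinate conditions. This yields joint measurability in radius and direction
    of the points on a ray. *)
Lemma measurable_fun_rV d (T : measurableType d) (f : T -> V) :
  (forall i, measurable_fun [set: T] (fun t => f t ord0 i)) ->
  measurable_fun [set: T] f.
Proof.
move=> mf; apply: (measurability (@open V)) => // _ [D oD <-].
rewrite setTI (open_rV_bigcup oD) preimage_bigcup.
rewrite bigcup_mkcond; apply: countable_bigcupT_measurable => // q.
case: ifPn => // _.
rewrite (_ : _ @^-1` _ = \bigcap_(i in [set: 'I_n])
    ((fun t => f t ord0 i) @^-1` `]ratr (q.1 ord0 i) - q.2.+1%:R^-1,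
                                    ratr (q.1 ord0 i) + q.2.+1%:R^-1[)).
  apply: fin_bigcap_measurable; first exact: finite_finset.
  by move=> i _; rewrite -[X in measurable X]setTI; apply: mf => //; exact: measurable_itv.
by apply/seteqP; split => [t h i _|t h i]; have := h i; rewrite /= in_itv/= -ltr_distl//; apply.
Qed.

Lemma measurable_ray (x : V) (c : R) :
  measurable_fun [set: R * V] (fun z => x + (c * z.1) *: z.2).
Proof.
apply: measurable_fun_rV => i; under eq_fun do rewrite !mxE.
apply: measurable_funD => //; apply: measurable_funM.
  by apply: measurable_funM => //; exact: measurable_fst.
exact: (measurableT_comp (measurable_coord i) measurable_snd).
Qed.

Lemma measurable_sphere : measurable (sphere (R := R) (n := n)).
Proof.
have m : measurable_fun [set: V] (@sqnorm R n).
  apply: measurable_sum => i; apply: measurable_funX; exact: measurable_coord.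
rewrite /sphere -[X in measurable X]setTI.
exact: (m measurableT _ (measurable_set1 1)).
Qed.

Lemma sphere_norm_le1 (w : V) : sphere w -> `|w| <= 1.
Proof.
move=> w1; apply: rV_norm_le => // i.
rewrite -(@ler_pXn2r _ 2)// ?nnegrE// expr1n real_normK ?num_real// -w1 /sqnorm.
by rewrite (bigD1 i)//= lerDl sumr_ge0// => j _; exact: sqr_ge0.
Qed.

End BorelRowVectors.

Section FubiniFinite.

(** [a] is a bare measure, so finiteness is first repackaged as a sigma-finite structure; Tonelli
    then applies to each part of the signed function [h]. *)
Lemma measurable_fun_integral_snd (R : realType) d1 d2 (T1 : measurableType d1)
    (T2 : measurableType d2) (a : {measure set T2 -> \bar R}) (h : T1 * T2 -> \bar R) :
  fin_num_fun a -> measurable_fun setT h ->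
  measurable_fun setT (fun x => \int[a]_y h (x, y))%E.
Proof.
move=> fa mh.
pose H1 := @isFinite.Build d2 T2 R a fa.
have sf : sigma_finite setT a by apply: fin_num_fun_sigma_finite => //; rewrite measure0.
pose H2 := @isSigmaFinite.Build d2 T2 R a sf.
pose H3 := @isSFinite.Build d2 T2 R a (sfinite_measure_sigma_finite sf).
pose b := HB.pack_for (SigmaFiniteMeasure.type T2 R) (Measure.sort a) H2 H3.
have mp : measurable_fun setT (fun x => \int[a]_y (h^\+ (x, y)))%E.
  by apply: (@measurable_fun_fubini_tonelli_F _ _ T1 T2 R b (h^\+)%E);
    [exact: measurable_funepos|move=> z; exact: funepos_ge0].
have mn : measurable_fun setT (fun x => \int[a]_y (h^\- (x, y)))%E.
  by apply: (@measurable_fun_fubini_tonelli_F _ _ T1 T2 R b (h^\-)%E);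
    [exact: measurable_funeneg|move=> z; exact: funeneg_ge0].
rewrite (_ : (fun x => _) = (fun x => \int[a]_y (h^\+ (x, y)) - \int[a]_y (h^\- (x, y)))%E).
  exact: emeasurable_funB.
apply/funext => x; rewrite integralE; congr (_ - _)%E; apply: eq_integral => y _.
  by rewrite !funeposE.
by rewrite !funenegE.
Qed.

End FubiniFinite.

Section SphericalIntegral.
Context {R : realType} {n : nat}.
Local Notation V := 'rV[R]_n.
Variables (s : R) (a : {measure set V -> \bar R}).

(** The function G of the overview. For a spectral measure and a measurable, locally bounded [v] the
    integral is finite, so [fine] loses nothing. *)
Definition sphere_delta (v : V -> R) (x : V) (rho : R) : R :=
  fine (\int[a]_(w in sphere (R := R) (n := n)) (delta v x (rho *: w))%:E).

Definition mass : R := fine (a (sphere (R := R) (n := n))).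

Lemma spectral_measure_mass : spectral_measure a ->
  a (sphere (R := R) (n := n)) = mass%:E /\ 0 < mass.
Proof.
case=> _ [a0 [L aL]].
have fa : a (sphere (R := R) (n := n)) \is a fin_num.
  by rewrite ge0_fin_numE// (le_lt_trans aL)// ltry.
by rewrite -lte_fin /mass fineK.
Qed.

Lemma spectral_measure_fin : spectral_measure a -> fin_num_fun a.
Proof.
move=> sa; have [aE _] := spectral_measure_mass sa; case: sa => aC _ U mU.
have mS := @measurable_sphere R n.
rewrite ge0_fin_numE//; apply: (@le_lt_trans _ _ (a setT)).
  by apply: le_measure; rewrite ?inE// subsetT.
have mC := measurableC mS.
have aT : a [set: V] = (a (sphere (R := R) (n := n)) + a (~` sphere (R := R) (n := n)))%E.
  by rewrite -(setUv (sphere (R := R) (n := n))); apply: measureU => //; exact: setICr.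
by rewrite aT aC adde0 aE ltry.
Qed.

Section LocallyBounded.
Variables (v : V -> R) (x : V).

(** Points x + rho w with w on the sphere stay in a bounded set for each rho, so this weak bound
    suffices for integrability over directions. *)
Definition locally_bounded := forall B : R, exists C : R,
  forall y : V, `|y| <= B -> `|v y| <= C.

Lemma measurable_ray_fun (c : R) : measurable_fun setT v ->
  measurable_fun [set: R * V] (fun z => v (x + (c * z.1) *: z.2)).
Proof. by move=> mv; exact: (measurableT_comp mv (measurable_ray x c)). Qed.

Let h (z : R * V) : R := v (x + z.1 *: z.2) + v (x - z.1 *: z.2).

Let measurable_h : measurable_fun setT v -> measurable_fun setT h.
Proof.
move=> mv; apply: measurable_funD.
  by have := measurable_ray_fun 1 mv; under eq_fun do rewrite mul1r.
have := measurable_ray_fun (-1) mv.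
by under eq_fun do rewrite mulN1r scaleNr.
Qed.

Lemma ray_bounded (rho : R) : locally_bounded ->
  exists C, forall w, sphere w -> `|h (rho, w)| <= C.
Proof.
move=> bv; have [C CP] := bv (`|x| + `|rho|).
exists (C + C) => w /sphere_norm_le1 w1.
have rw : `|rho *: w| <= `|rho| by rewrite normrZ ler_piMr.
apply: (le_trans (ler_normD _ _)); apply: lerD; apply: CP.
  by apply: (le_trans (ler_normD _ _)); rewrite lerD2l.
by apply: (le_trans (ler_normB _ _)); rewrite lerD2l.
Qed.

Lemma integrable_sphere (f : V -> R) : spectral_measure a ->
  measurable_fun setT f -> (exists C, forall w, sphere w -> `|f w| <= C) ->
  a.-integrable (sphere (R := R) (n := n)) (EFin \o f).
Proof.
move=> sa mf [C CP]; apply: measurable_bounded_integrable.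
- exact: measurable_sphere.
- by have [-> _] := spectral_measure_mass sa; exact: ltry.
- exact: measurable_funTS.
- exists C; split; first exact: num_real.
  by move=> M CM w /CP h'; apply: le_trans h' (ltW CM).
Qed.

Let measurable_h_snd rho : measurable_fun setT v ->
  measurable_fun setT (fun w => h (rho, w)).
Proof.
move=> mv; exact: (measurableT_comp (measurable_h mv) (measurable_pair1 rho)).
Qed.

Lemma deltaE rho w : delta v x (rho *: w) = 2 * v x - h (rho, w).
Proof. by rewrite /delta /h /=; ring. Qed.

Lemma integral_sphere_sum rho : spectral_measure a ->
  measurable_fun setT v -> locally_bounded ->
  (\int[a]_(w in sphere (R := R) (n := n)) (v (x + rho *: w) + v (x - rho *: w))%:E =
   (2 * mass * v x - sphere_delta v x rho)%:E)%E /\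
  (\int[a]_(w in sphere (R := R) (n := n)) (delta v x (rho *: w))%:E =
   (sphere_delta v x rho)%:E)%E.
Proof.
move=> sa mv bv; have [aE _] := spectral_measure_mass sa.
have mS := @measurable_sphere R n.
have ih : a.-integrable (sphere (R := R) (n := n)) (EFin \o (fun w => h (rho, w))).
  by apply: integrable_sphere => //; [exact: measurable_h_snd|exact: ray_bounded].
have ic : a.-integrable (sphere (R := R) (n := n)) (EFin \o cst (2 * v x)).
  by apply: integrable_sphere => //; exists `|2 * v x|.
have fh : (\int[a]_(w in sphere (R := R) (n := n)) (h (rho, w))%:E)%E \is a fin_num.
  exact: integrable_fin_num ih.
have dE : (\int[a]_(w in sphere (R := R) (n := n)) (delta v x (rho *: w))%:E =
  (2 * mass * v x)%:E -
    \int[a]_(w in sphere (R := R) (n := n)) (h (rho, w))%:E)%E.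
  under eq_integral do rewrite deltaE EFinB.
  rewrite integralB_EFin// integral_cst// aE -EFinM.
  by congr (_%:E - _)%E; ring.
have fd : (\int[a]_(w in sphere (R := R) (n := n)) (delta v x (rho *: w))%:E)%E
    \is a fin_num by rewrite dE fin_numB.
split; last by rewrite /sphere_delta fineK.
rewrite EFinB /sphere_delta fineK// dE.
by rewrite fin_num_oppeB// addeA subee// add0e.
Qed.

Lemma measurable_sphere_delta : spectral_measure a -> measurable_fun setT v ->
  locally_bounded -> measurable_fun setT (sphere_delta v x).
Proof.
move=> sa mv bv; have mS := @measurable_sphere R n.
(* The sphere is moved into an indicator, so that the integrand is one measurable function on the
   whole product. *)
have E : sphere_delta v x = (fun rho => 2 * mass * v x -
    fine (\int[a]_w ((h (rho, w))%:E * (\1_(sphere (R := R) (n := n)) w)%:E))%E).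
  apply/funext => rho; have [+ _] := integral_sphere_sum rho sa mv bv.
  rewrite integral_mkcond => H.
  rewrite (_ : (\int[a]_w _)%E = (2 * mass * v x - sphere_delta v x rho)%:E).
    by rewrite /= subKr.
  rewrite -H; apply: eq_integral => w _; rewrite patchE indicE.
  by case: ifPn => wS; rewrite ?mule1 ?mule0.
rewrite E; apply: measurable_funB => //.
apply: measurableT_comp => //.
apply: (measurable_fun_integral_snd (spectral_measure_fin sa)
  (h := fun z => ((h z)%:E * (\1_(sphere (R := R) (n := n)) z.2)%:E)%E)).
apply: emeasurable_funM; first by apply/measurable_EFinP; exact: measurable_h.
apply/measurable_EFinP.
exact: (measurableT_comp (measurable_indic mS) measurable_snd).
Qed.

Lemma integrable_delta (rho : R) : spectral_measure a -> measurable_fun setT v ->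
  locally_bounded ->
  a.-integrable (sphere (R := R) (n := n)) (EFin \o (fun w => delta v x (rho *: w))).
Proof.
move=> sa mv bv; apply: integrable_sphere => //.
  by under eq_fun do rewrite deltaE; apply: measurable_funB => //; exact: measurable_h_snd.
have [C CP] := ray_bounded rho bv; exists (`|2 * v x| + C) => w /CP wC.
by rewrite deltaE (le_trans (ler_normB _ _))// lerD2l.
Qed.

Lemma sphere_delta_ge (rho c : R) : spectral_measure a ->
  measurable_fun setT v -> locally_bounded ->
  (forall w, sphere w -> c <= delta v x (rho *: w)) ->
  mass * c <= sphere_delta v x rho.
Proof.
move=> sa mv bv dc; have [aE _] := spectral_measure_mass sa.
have mS := @measurable_sphere R n.
have [_ dE] := integral_sphere_sum rho sa mv bv.
rewrite -lee_fin -dE mulrC EFinM -aE -integral_cst//.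
apply: le_integral => //; last by move=> w /set_mem /dc; rewrite lee_fin.
- by apply: integrable_sphere => //; exists `|c|.
- exact: integrable_delta.
Qed.

Lemma sphere_delta_le (rho c : R) : spectral_measure a ->
  measurable_fun setT v -> locally_bounded ->
  (forall w, sphere w -> delta v x (rho *: w) <= c) ->
  sphere_delta v x rho <= mass * c.
Proof.
move=> sa mv bv dc; have [aE _] := spectral_measure_mass sa.
have mS := @measurable_sphere R n.
have [_ dE] := integral_sphere_sum rho sa mv bv.
rewrite -lee_fin -dE mulrC EFinM -aE -integral_cst//.
apply: le_integral => //; last by move=> w /set_mem /dc; rewrite lee_fin.
- exact: integrable_delta.
- by apply: integrable_sphere => //; exists `|c|.
Qed.

Lemma LopE : spectral_measure a -> measurable_fun setT v -> locally_bounded ->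
  Lop s a v x = kern_integral s 0 (sphere_delta v x).
Proof.
move=> sa mv bv; apply: eq_integral => rho; rewrite inE/= in_itv/= andbT => rho0.
have [_ ->] := integral_sphere_sum rho sa mv bv.
rewrite -EFinM /kern expr0n/= subr0; congr (_ * _^-1)%:E.
rewrite -powR_mulrn ?(ltW rho0)// -powRrM powRD ?(gt_eqF rho0) ?implybT//.
by rewrite powRr1 ?(ltW rho0)// mulrC.
Qed.

Lemma MrE r : spectral_measure a -> measurable_fun setT v -> locally_bounded ->
  Mr s a r v x = ((sin (pi * s) / pi * mass^-1 * r `^ (2 * s))%:E *
    kern_integral s r (fun rho => (2 * mass * v x - sphere_delta v x rho)%R))%E.
Proof.
move=> sa mv bv; congr (_ * _)%E; apply: eq_integral => rho _.
by have [-> _] := integral_sphere_sum rho sa mv bv.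
Qed.

End LocallyBounded.

End SphericalIntegral.

(** * Second differences controlled by second partial derivatives *)

Section SecondDifference.
Context {R : realType} {n : nat}.
Local Notation V := 'rV[R]_n.
Local Notation e := (@unitv R n).

Lemma is_derive_line (f : V -> R) (z v : V) (t : R) :
  derivable f (z + t *: v) v ->
  is_derive t (1 : R) (fun t => f (z + t *: v)) ('D_v f (z + t *: v)).
Proof.
have E : (fun h : R => h^-1 *: (((fun t => f (z + t *: v)) \o shift t) (h *: (1 : R))
      - f (z + t *: v))) =
    (fun h : R => h^-1 *: ((f \o shift (z + t *: v)) (h *: v) - f (z + t *: v))).
  apply/funext => h /=; congr (_ *: (f _ - _)).
  by rewrite scalerDl addrCA /GRing.scale/= mulr1.
move=> df; apply: DeriveDef; first by rewrite /derivable E.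
by rewrite /derive E.
Qed.

Lemma coord_increment (f : V -> R) (z v : V) (tau c C : R) :
  (forall t, `|t| <= `|tau| ->
     derivable f (z + t *: v) v /\ `|'D_v f (z + t *: v) - c| <= C) ->
  `|f (z + tau *: v) - f z - c * tau| <= C * `|tau|.
Proof.
move=> H; pose g t := f (z + t *: v).
have [t tt gE] : exists2 t, `|t| <= `|tau| & g tau - g 0 = 'D_v f (z + t *: v) * tau.
  (* The mean value theorem wants ordered end points, while [tau] may be negative. *)
  have dg a b : `|a| <= `|tau| -> `|b| <= `|tau| -> a <= b ->
      exists2 t, `|t| <= `|tau| & g b - g a = 'D_v f (z + t *: v) * (b - a).
    move=> ha hb ab.
    have inT t : t \in `[a, b] -> `|t| <= `|tau|.
      rewrite in_itv/= => /andP[at' tb]; move: ha hb; rewrite !ler_norml.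
      by move=> /andP[h1 _] /andP[_ h2]; apply/andP; split; lra.
    have [||t tab ->] := @MVT_segment R g (fun t => 'D_v f (z + t *: v)) a b ab.
    - move=> t tab; apply: is_derive_line; have [] := H t _ => //.
      by apply: inT; apply: subset_itv_oo_cc tab.
    - apply: derivable_within_continuous => t /inT /H[dt _].
      by have [] := is_derive_line dt.
    by exists t => //; exact: inT.
  have [tau0|tau0] := leP 0 tau.
    have [|||t tt] := dg 0 tau => //; first by rewrite normr0.
    by rewrite subr0; exists t.
  have [|||t tt E] := dg tau 0 => //; [by rewrite normr0|exact: ltW|].
  by exists t => //; rewrite -opprB E sub0r mulrN opprK.
have {}gE : f (z + tau *: v) - f z = 'D_v f (z + t *: v) * tau.
  by rewrite -gE /g scale0r addr0.
rewrite gE -mulrBl normrM ler_wpM2r//.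
by have [] := H t tt.
Qed.

(** Only partial derivatives are available, so the segment from x to x + y is replaced by a path
    along the axes, each edge costing at most C |y|. The norm is the maximum norm, so the path stays
    in the box around x. *)
Lemma increment_estimate (f : V -> R) (x y : V) (c : 'I_n -> R) (C : R) : 0 <= C ->
  (forall z, `|z - x| <= `|y| -> forall i,
     derivable f z (e i) /\ `|'D_(e i) f z - c i| <= C) ->
  `|f (x + y) - f x - \sum_i c i * y ord0 i| <= n%:R * C * `|y|.
Proof.
move=> C0 H.
pose p (k : nat) : V := \row_i (if (i < k)%N then y ord0 i else 0).
have step k : (k <= n)%N ->
    `|f (x + p k) - f x - \sum_(i < n | (i < k)%N) c i * y ord0 i| <= k%:R * C * `|y|.
  elim: k => [_|k ih kn].
    have -> : p 0 = 0 by apply/rowP => i; rewrite !mxE.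
    by rewrite addr0 subrr big_pred0// subr0 normr0 !mul0r.
  pose i0 : 'I_n := Ordinal kn.
  have pS : p k.+1 = p k + y ord0 i0 *: e i0.
    apply/rowP => i; rewrite !mxE eqxx/= ltnS leq_eqVlt.
    have -> : (i == k :> nat) = (i == i0) by [].
    have [->|ii0] := eqVneq i i0; first by rewrite ltnn/= mulr1 add0r.
    by rewrite /= mulr0 addr0.
  have sumS : \sum_(i < n | (i < k.+1)%N) c i * y ord0 i =
      \sum_(i < n | (i < k)%N) c i * y ord0 i + c i0 * y ord0 i0.
    rewrite (bigD1 i0) ?ltnS//= addrC; congr (_ + _); apply: eq_bigl => i.
    by rewrite ltnS [RHS]ltn_neqAle andbC.
  have := @coord_increment f (x + p k) (e i0) (y ord0 i0) (c i0) C.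
  have inbox t : `|t| <= `|y ord0 i0| -> `|x + p k + t *: e i0 - x| <= `|y|.
    move=> ty; rewrite addrAC (addrC x) addrK.
    apply: rV_norm_le => // i; rewrite !mxE eqxx/=.
    have [->|ii0] := eqVneq i i0.
      by rewrite ltnn add0r mulr1 (le_trans ty)// coord_le_norm.
    by rewrite mulr0 addr0; case: ifPn => _; [exact: coord_le_norm|rewrite normr0].
  move=> /(_ (fun t ty => H _ (inbox t ty) i0)); rewrite -(addrA x) -pS => h1.
  have h2 := ih (ltnW kn).
  rewrite sumS -natr1 !mulrDl mul1r.
  rewrite (_ : _ - _ = (f (x + p k) - f x - \sum_(i < n | (i < k)%N) c i * y ord0 i) +
    (f (x + p k.+1) - f (x + p k) - c i0 * y ord0 i0)); last by ring.
  apply: (le_trans (ler_normD _ _)); apply: lerD => //.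
  by apply: (le_trans h1); rewrite ler_wpM2l// coord_le_norm.
have := step n (leqnn n).
have -> : p n = y by apply/rowP => i; rewrite mxE ltn_ord.
by rewrite (eq_bigl xpredT)// => i; rewrite ltn_ord.
Qed.

(** Each first partial varies by at most n K |y|, so each first-order remainder, at y and at -y, is
    at most n (n K |y|) |y|. The linear terms cancel in the sum. *)
Lemma second_difference_le (phi : V -> R) (x y : V) (K : R) : 0 <= K ->
  (forall z, `|z - x| <= `|y| -> forall i, derivable phi z (e i)) ->
  (forall z, `|z - x| <= `|y| -> forall i j, derivable ('D_(e j) phi) z (e i)) ->
  (forall z, `|z - x| <= `|y| -> forall i j, `|'D_(e i) ('D_(e j) phi) z| <= K) ->
  `|delta phi x y| <= 2 * n%:R ^+ 2 * K * `|y| ^+ 2.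
Proof.
move=> K0 d1 d2 D2.
have lip z j : `|z - x| <= `|y| ->
    `|'D_(e j) phi z - 'D_(e j) phi x| <= n%:R * K * `|y|.
  move=> zy; have := @increment_estimate ('D_(e j) phi) x (z - x) (fun=> 0) K K0.
  rewrite (addrC x) subrK.
  under eq_bigr do rewrite mul0r.
  rewrite big1// subr0 => /(_ _)h; apply: (le_trans (h _)).
    move=> z' z'z i; have z'y := le_trans z'z zy.
    by split; [exact: d2|rewrite subr0; exact: D2].
  by rewrite ler_wpM2l// mulr_ge0.
have side y' : `|y'| = `|y| -> `|phi (x + y') - phi x -
    \sum_i 'D_(e i) phi x * y' ord0 i| <= n%:R * (n%:R * K * `|y|) * `|y|.
  move=> y'y; rewrite -{2}y'y; apply: increment_estimate; first by rewrite !mulr_ge0.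
  by rewrite y'y => z zy i; split; [exact: d1|exact: lip].
have h1 := side y erefl; have h2 := side (- y) (normrN y).
rewrite (_ : delta phi x y = - ((phi (x + y) - phi x - \sum_i 'D_(e i) phi x * y ord0 i)
  + (phi (x - y) - phi x - \sum_i 'D_(e i) phi x * (- y) ord0 i))).
  rewrite normrN (le_trans (ler_normD _ _))// (le_trans (lerD h1 h2))//.
  by rewrite le_eqVlt; apply/orP; left; apply/eqP; ring.
rewrite /delta.
have -> : \sum_i 'D_(e i) phi x * (- y) ord0 i = - \sum_i 'D_(e i) phi x * y ord0 i.
  by rewrite -sumrN; apply: eq_bigr => i _; rewrite mxE mulrN.
ring.
Qed.

Lemma ler_sum2 (T : 'I_n -> 'I_n -> R) i j : (forall i j, 0 <= T i j) ->
  T i j <= \sum_i \sum_j T i j.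
Proof.
move=> T0; rewrite (bigD1 i)//= [X in _ <= X + _](bigD1 j)//= -addrA lerDl.
apply: addr_ge0; first by apply: sumr_ge0 => k _; exact: T0.
by apply: sumr_ge0 => k _; apply: sumr_ge0 => l _; exact: T0.
Qed.

Lemma C2_second_difference (U : set V) (phi : V -> R) (x : V) :
  open U -> U x -> C2_closure U phi ->
  exists K rho : R, [/\ 0 <= K, 0 < rho, (forall y, `|y| < rho -> U (x + y)) &
    forall y, `|y| < rho -> `|delta phi x y| <= K * `|y| ^+ 2].
Proof.
move=> oU Ux [_ d1 d2 _ cd2].
have near_bound i j : \forall z \near x,
    `|'D_(e i) ('D_(e j) phi) z| <= `|'D_(e i) ('D_(e j) phi) x| + 1.
  have [g [cg gE]] := cd2 i j.
  have cgU : {in U, continuous g}.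
    rewrite -(continuous_open_subspace g oU); apply: continuous_subspaceW cg.
    exact: subset_closure.
  have := cgU x (mem_set Ux) => /cvgrPdist_le /(_ 1 ltr01) cgx.
  near=> z; have Uz : U z by near: z; exact: open_nbhs_nbhs.
  rewrite -!gE// -lerBlDl; apply: (le_trans (lerB_dist _ _)).
  by rewrite distrC; near: z.
pose K := \sum_i \sum_j (`|'D_(e i) ('D_(e j) phi) x| + 1).
have term0 i j : 0 <= `|'D_(e i) ('D_(e j) phi) x| + 1 by rewrite addr_ge0.
have termK i j : `|'D_(e i) ('D_(e j) phi) x| + 1 <= K.
  exact: (@ler_sum2 (fun i j => `|'D_(e i) ('D_(e j) phi) x| + 1) i j term0).
have K0 : 0 <= K by apply: sumr_ge0 => i _; apply: sumr_ge0 => j _.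
have nb : \forall z \near x, forall i j,
    `|'D_(e i) ('D_(e j) phi) z| <= `|'D_(e i) ('D_(e j) phi) x| + 1.
  pose P i j (z : V) := `|'D_(e i) ('D_(e j) phi) z| <= `|'D_(e i) ('D_(e j) phi) x| + 1.
  apply: (@filter_forall V 'I_n (fun i z => forall j, P i j z) (nbhs x) _) => i.
  exact: (@filter_forall V 'I_n (P i) (nbhs x) _ (near_bound i)).
have : \forall z \near x, U z /\ forall i j, `|'D_(e i) ('D_(e j) phi) z| <= K.
  near=> z; split; first by near: z; exact: open_nbhs_nbhs.
  move=> i j; apply: (@le_trans _ _ (`|'D_(e i) ('D_(e j) phi) x| + 1)).
    by move: i j; near: z.
  exact: termK.
move=> /nbhs_ballP[rho /= rho0 H].
have H' z : `|z - x| < rho -> U z /\ forall i j, `|'D_(e i) ('D_(e j) phi) z| <= K.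
  by move=> zx; apply: H; rewrite -ball_normE/= distrC.
exists (2 * n%:R ^+ 2 * K), rho; split => //.
- by rewrite !mulr_ge0// exprn_ge0.
- by move=> y yrho; have [|] := H' (x + y); rewrite // addrAC subrr add0r.
move=> y yrho.
have inU z : `|z - x| <= `|y| -> U z /\ forall i j, `|'D_(e i) ('D_(e j) phi) z| <= K.
  by move=> zy; apply: H'; exact: le_lt_trans yrho.
apply: second_difference_le => // z /inU[Uz Dz].
- by move=> i; exact: d1.
- by move=> i j; exact: d2.
- exact: Dz.
Unshelve. all: by end_near. Qed.

End SecondDifference.

(** * Touching functions *)

Lemma bigO_right0P (R : realType) (f : R -> R) (F0 := @right0 R) :
  f =O_F0 (fun r : R => r ^+ 2) <->
  exists2 C, 0 < C & \forall r \near 0^'+, `|f r| <= C * r ^+ 2.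
Proof.
have E C r : (`|f r| <= C * `|r ^+ 2|) = (`|f r| <= C * r ^+ 2).
  by rewrite (ger0_norm (sqr_ge0 r)).
rewrite /F0 /right0; split => [/eqO_exP|] [C C0 H].
  by exists C => //; near=> r; rewrite -E; near: r.
by apply/eqO_exP; exists C => //; near=> r; rewrite E; near: r.
Unshelve. all: by end_near. Qed.

Section Touch.
Context {R : realType} {n : nat}.
Local Notation V := 'rV[R]_n.
Variables (s : R) (a : {measure set V -> \bar R}) (Omega : set V) (u : V -> R).

Lemma touchE (U : set V) (phi : V -> R) (y : V) : U y -> touch U phi u y = phi y.
Proof. by move=> Uy; rewrite /touch mem_set. Qed.

Lemma measurable_touch (U : set V) (phi : V -> R) : open U -> C2_closure U phi ->
  measurable_fun setT u -> measurable_fun setT (touch U phi u).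
Proof.
move=> oU [cphi _ _ _ _] mu.
have mU := open_measurable_rV oU.
have UE : (fun y : V => y \in U) @^-1` [set true] = U.
  by apply/seteqP; split => y /=; [move=> /set_mem|move=> /mem_set ->].
apply: measurable_fun_if => //.
- by apply: (measurable_fun_bool true); rewrite setTI UE.
- rewrite setTI UE; apply: open_continuous_measurable_rV => //.
  rewrite -(continuous_open_subspace phi oU); apply: continuous_subspaceW cphi.
  exact: subset_closure.
- exact: measurable_funTS.
Qed.

(** [phi] is continuous on the closure of [U], whose intersection with a closed ball is compact;
    outside [U] the bound on [u] applies. *)
Lemma locally_bounded_touch (U : set V) (phi : V -> R) (M : R) :
  C2_closure U phi -> (forall y, `|u y| <= M) -> locally_bounded (touch U phi u).
Proof.
move=> [cphi _ _ _ _] uM B.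
pose A : set V := closure U `&` [set y | `|y| <= B].
have cA : compact A.
  apply: bounded_closed_compact.
    exists B; split; first exact: num_real.
    by move=> C BC y [_ /= yB]; apply: le_trans yB (ltW BC).
  apply: closedI; first exact: closed_closure.
  apply: (@preimage_closed _ _ (fun y : V => `|y|) [set z : R | z <= B]).
    by move=> y _; exact: norm_continuous.
  exact: closed_le.
have : compact (phi @` A).
  apply: continuous_compact => //; apply: continuous_subspaceW cphi.
  by move=> y [].
move=> /compact_bounded[C [_ CP]].
exists (Num.max M (C + 1)) => y yB; rewrite /touch; case: ifPn => yU.
  rewrite le_max; apply/orP; right; apply: (CP (C + 1)); first by rewrite ltrDl.
  by exists y => //; split => //; apply: subset_closure; exact: set_mem.
by rewrite le_max uM.
Qed.

Section AtPoint.
Variables (x : V) (U : set V) (phi : V -> R) (M : R).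
Hypotheses (s01 : 0 < s < 1) (sa : spectral_measure a) (oU : open U) (Ux : U x)
  (C2phi : C2_closure U phi) (mu : measurable_fun setT u)
  (uM : forall y, `|u y| <= M) (phix : phi x = u x).

Let v := touch U phi u.
Let mv : measurable_fun setT v := measurable_touch oU C2phi mu.
Let bv : locally_bounded v := locally_bounded_touch C2phi uM.

Lemma sphere_delta_near : exists K rho : R, [/\ 0 <= K, 0 < rho &
  forall r, 0 < r < rho -> `|sphere_delta a v x r| <= mass a * K * r ^+ 2].
Proof.
have [K [rho [K0 rho0 inU dK]]] := C2_second_difference oU Ux C2phi.
exists K, rho; split => // r /andP[r0 rrho].
suff H w : sphere w -> `|delta v x (r *: w)| <= K * r ^+ 2.
  rewrite -mulrA ler_norml -mulrN sphere_delta_ge ?sphere_delta_le// => w /H;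
    by rewrite ler_norml => /andP[].
move=> /sphere_norm_le1 w1.
have rw : `|r *: w| <= r by rewrite normrZ gtr0_norm// ler_piMr// ltW.
have rwrho := le_lt_trans rw rrho.
have -> : delta v x (r *: w) = delta phi x (r *: w).
  rewrite /delta /v !touchE//; first exact: inU.
  by apply: inU; rewrite normrN.
apply: (le_trans (dK _ rwrho)); rewrite ler_wpM2l//.
by rewrite ler_pXn2r// nnegrE// ltW.
Qed.

Let mG : measurable_fun (`]0, +oo[%classic : set R) (sphere_delta a v x).
Proof. by apply: measurable_funTS; exact: measurable_sphere_delta. Qed.

(** Touching from below puts [v] under [u], hence under [M], which bounds the second differences
    from below: the one-sided hypothesis of the core lemma. *)
Lemma Lop_ge0_mean_value : (forall y, U y -> y <> x -> phi y < u y) ->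
  (0 <= Lop s a v x)%E <->
  exists f : R -> R,
    (exists2 C, 0 < C & \forall r \near 0^'+, `|f r| <= C * r ^+ 2) /\
    forall r, 0 < r -> (Mr s a r v x + (f r)%:E <= (v x)%:E)%E.
Proof.
move=> phiu; have [aE A0] := spectral_measure_mass sa.
have [K [rho [K0 rho0 GK]]] := sphere_delta_near.
have vM y : v y <= M.
  apply: le_trans (le_trans (ler_norm _) (uM y)).
  rewrite /v /touch; case: ifPn => // /set_mem Uy.
  by have [->|/eqP yx] := eqVneq y x; [rewrite phix|exact/ltW/phiu].
have GM r : 0 < r -> - (mass a * (2 * (M - v x))) <= sphere_delta a v x r.
  move=> r0; rewrite -mulrN; apply: sphere_delta_ge => // w _.
  by rewrite /delta; have := vM (x - r *: w); have := vM (x + r *: w); lra.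
have AK : 0 <= mass a * K by rewrite mulr_ge0// ltW.
rewrite LopE//; apply: (iff_trans (mean_value_core (v x) s01 A0 rho0 AK mG GK GM)).
by split=> -[f [fO fP]]; exists f; split => // r r0; have := fP r r0; rewrite MrE.
Qed.

Lemma Lop_le0_mean_value : (forall y, U y -> y <> x -> u y < phi y) ->
  (Lop s a v x <= 0)%E <->
  exists f : R -> R,
    (exists2 C, 0 < C & \forall r \near 0^'+, `|f r| <= C * r ^+ 2) /\
    forall r, 0 < r -> ((v x)%:E <= Mr s a r v x + (f r)%:E)%E.
Proof.
move=> uphi; have [aE A0] := spectral_measure_mass sa.
have [K [rho [K0 rho0 GK]]] := sphere_delta_near.
have vM y : - M <= v y.
  have uN : - M <= u y by have := uM y; rewrite ler_norml => /andP[].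
  apply: (le_trans uN); rewrite /v /touch; case: ifPn => // /set_mem Uy.
  by have [->|/eqP yx] := eqVneq y x; [rewrite phix|exact/ltW/uphi].
have GM r : 0 < r -> sphere_delta a v x r <= mass a * (2 * (M + v x)).
  move=> r0; apply: sphere_delta_le => // w _.
  by rewrite /delta; have := vM (x - r *: w); have := vM (x + r *: w); lra.
have AK : 0 <= mass a * K by rewrite mulr_ge0// ltW.
rewrite LopE//; apply: (iff_trans (mean_value_core_sub (v x) s01 A0 rho0 AK mG GK GM)).
by split=> -[f [fO fP]]; exists f; split => // r r0; have := fP r r0; rewrite MrE.
Qed.

End AtPoint.

Lemma continuous_lsc_on (A : set V) : {within A, continuous u} -> lsc_on A u.
Proof.
move=> /subspace_continuousP cu x Ax e e0.
have /cvgrPdist_lt /(_ e e0) := cu x Ax.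
rewrite near_withinE; apply: filterS => y H /H; rewrite /from_subspace ltr_norml => /andP[_ h]; lra.
Qed.

Lemma continuous_usc_on (A : set V) : {within A, continuous u} -> usc_on A u.
Proof.
move=> /subspace_continuousP cu x Ax e e0.
have /cvgrPdist_lt /(_ e e0) := cu x Ax.
rewrite near_withinE; apply: filterS => y H /H; rewrite /from_subspace ltr_norml => /andP[h _]; lra.
Qed.

End Touch.

Theorem theorem1p1 (R : realType) (n : nat) (s : R)
  (a : {measure set 'rV[R]_n -> \bar R}) (Omega : set 'rV[R]_n) (u : 'rV[R]_n -> R) :
  (0 < n)%N -> 0 < s < 1 -> spectral_measure a -> open Omega -> Linf u ->
  {within closure Omega, continuous u} ->
  (forall x, Omega x -> mv_visc s a Omega u x) <-> visc_solution s a Omega u.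
Proof.
move=> _ s01 sa _ Lu cu; have [mu [M uM]] := Lu.
have lu := continuous_lsc_on cu; have uu := continuous_usc_on cu.
(* Both notions quantify over the same [U] and [phi], so the equivalence is applied to each choice;
   continuity supplies both semicontinuities. *)
split => [mean|[_ [[_ [_ super]] [_ [_ sub]]]] x Ox].
  split=> //; split; split => //; split => // x U phi Ox oU Ux UO C2 phix touching.
    apply/(Lop_ge0_mean_value s01 sa oU Ux C2 mu uM phix touching).
    have [[_ [_ above]] _] := mean x Ox.
    have [f [/bigO_right0P fO fP]] := above U phi oU Ux UO C2 phix touching.
    by exists f.
  apply/(Lop_le0_mean_value s01 sa oU Ux C2 mu uM phix touching).
  have [_ [_ [_ below]]] := mean x Ox.
  have [f [/bigO_right0P fO fP]] := below U phi oU Ux UO C2 phix touching.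
  by exists f.
split; split=> //; split => // U phi oU Ux UO C2 phix touching.
  have /(Lop_ge0_mean_value s01 sa oU Ux C2 mu uM phix touching)[f [fO fP]] :=
    super x U phi Ox oU Ux UO C2 phix touching.
  by exists f; split => //; apply/bigO_right0P.
have /(Lop_le0_mean_value s01 sa oU Ux C2 mu uM phix touching)[f [fO fP]] :=
  sub x U phi Ox oU Ux UO C2 phix touching.
by exists f; split => //; apply/bigO_right0P.
Qed.
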